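(* There is a constant $d_0$ such that for all integers $s\geq 0$ and $t\geq 3$ with $s \leq 10^{-5}\,\frac{t}{\ln t}$, for every graph $H$ with exactly $s+t$ vertices and every set $S$ of $s$ vertices in $H$ such that $d(H-S)\geq d_0$, $$f(H) \leq 3.895\,t\sqrt{\ln d(H-S)}.$$
   Context: Graphs are finite and simple. For a graph $G$, $d(G)$ denotes the average degree of $G$, i.e. $d(G)=2|E(G)|/|V(G)|$. A graph $H$ is a minor of a graph $G$ (equivalently, $G$ contains an $H$-minor) if a graph isomorphic to $H$ can be constructed from $G$ by vertex deletion, edge deletion and edge contraction. For a graph $H$, define $$f(H) := \inf\{D \in \mathbb{R} : \text{every graph } G \text{ with } d(G)\geq D \text{ contains an } H\text{-minor}\}.$$ For $S\subseteq V(H)$, $H-S$ is the graph obtained from $H$ by deleting the vertices in $S$. *)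

(* Defs.v *)
From mathcomp Require Import all_boot.

Set Implicit Arguments.
Unset Strict Implicit.
Unset Printing Implicit Defensive.

Record sgraph := SGraph {
  vertex :> finType;
  adj : rel vertex;
  adj_sym : symmetric adj;
  adj_irrefl : irreflexive adj }.

Arguments adj {G} : rename.

Definition edges (G : sgraph) : {set {set G}} :=
  [set e : {set G} |
    [exists x, exists y, adj x y && (e == [set x; y])]].

Section DeleteVertices.
Variables (G : sgraph) (S : {set G}).

Definition delv_adj : rel {u : G | u \notin S} :=
  fun u v => adj (val u) (val v).

Lemma delv_sym : symmetric delv_adj.
Proof. by move=> u v; apply: adj_sym. Qed.

Lemma delv_irrefl : irreflexive delv_adj.
Proof. by move=> u; apply: adj_irrefl. Qed.

Definition delete_vertices : sgraph := SGraph delv_sym delv_irrefl.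
End DeleteVertices.

Section DeleteEdge.
Variables (G : sgraph) (x y : G).

Definition dele_adj : rel G :=
  fun u v => adj u v && ([set u; v] != [set x; y]).

Lemma dele_sym : symmetric dele_adj.
Proof. by move=> u v; rewrite /dele_adj adj_sym setUC. Qed.

Lemma dele_irrefl : irreflexive dele_adj.
Proof. by move=> u; rewrite /dele_adj adj_irrefl. Qed.

Definition delete_edge : sgraph := SGraph dele_sym dele_irrefl.
End DeleteEdge.

(* The vertex y is merged into x: the new graph lives on the vertices other
   than y, with x standing for the merged vertex; loops and parallel edges are
   discarded. *)
Section Contract.
Variables (G : sgraph) (x y : G).

Definition contr_map (z : G) : G := if z == y then x else z.

Definition contr_adj : rel {u : G | u != y} := fun u v =>
  (u != v) &&
  [exists a, exists b, [&& contr_map a == val u, contr_map b == val v & adj a b]].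

Lemma contr_sym : symmetric contr_adj.
Proof.
move=> u v; rewrite /contr_adj eq_sym; congr (_ && _).
by apply/idP/idP => /existsP[a /existsP[b /and3P[ha hb hab]]];
  apply/existsP; exists b; apply/existsP; exists a; rewrite ha hb adj_sym.
Qed.

Lemma contr_irrefl : irreflexive contr_adj.
Proof. by move=> u; rewrite /contr_adj eqxx. Qed.

Definition contract_edge : sgraph := SGraph contr_sym contr_irrefl.
End Contract.

Definition isomorphic (H G : sgraph) : Prop :=
  exists2 f : H -> G, bijective f & {mono f : u v / adj u v}.

(* minor H G : H is a minor of G. *)
Inductive minor (H : sgraph) : sgraph -> Prop :=
| minor_iso (G : sgraph) : isomorphic H G -> minor H G
| minor_delete_vertex (G : sgraph) (v : G) :
    minor H (delete_vertices [set v]) -> minor H G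
| minor_delete_edge (G : sgraph) (x y : G) :
    adj x y -> minor H (delete_edge x y) -> minor H G
| minor_contract (G : sgraph) (x y : G) :
    adj x y -> minor H (contract_edge x y) -> minor H G.

(* Required only here: the set notations of MathComp-Analysis clash with those
   of finset used above. *)
From mathcomp Require Import all_order all_algebra.
From mathcomp Require Import all_classical all_reals all_analysis.

Local Open Scope ring_scope.

(* Takes the junk value 0 on the graph with no vertices. *)
Definition avg_deg (R : realType) (G : sgraph) : R :=
  2 * #|edges G|%:R / #|G|%:R.

(* The infimum is taken in the extended reals, so that it would be +oo, and not
   a junk real value, if no D were suitable.  The graph with no vertices is
   left out, as its average degree is undefined. *)
Definition minor_threshold (R : realType) (H : sgraph) : \bar R :=
  ereal_inf [set D%:E | D in
    [set D : R | forall G : sgraph,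
       (0 < #|G|)%N -> D <= avg_deg R G -> minor H G]%classic]%classic.

(* Main.v *)
Require Import Defs.
From mathcomp Require Import all_boot all_order all_fingroup all_algebra.
From mathcomp Require Import zify ring lra.

Set Implicit Arguments.
Unset Strict Implicit.
Unset Printing Implicit Defensive.

Import Order.TTheory GRing.Theory Num.Theory.

(** Put t = |H| - |S|, d = d(H - S), L = sqrt (ln d) and D = 3.895 t L, and let
    G have average degree at least D. An H-minor of G is built inside a dense
    minor of G from randomly chosen branch sets.

    The host. Delete and contract as long as the average degree stays at least
    D. In the end every edge lies in about D/2 triangles and some vertex has
    degree at most about D, so its closed neighbourhood U satisfies
    |U| <= 2k + 1 and has minimum degree more than k, with k the integer part
    of D/2 ([dense_nbhd]). Any two vertices of U should moreover be joined by a
    connected set of bounded size avoiding any prescribed set of at most k/40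
    vertices. If this fails, then removing few vertices splits U into two parts
    with no edge between them, and the smaller part is so close to complete that
    it has the property ([link_dichotomy]).

    The branch sets. Each of N ~ 5t/4 indices i receives a hub, a connected set
    K i that dominates almost all of U ([hubs]), and a random set A i of
    l ~ 13/9 L vertices. These sets fit because 5/4 * 13/9 * t L < D/2: this is
    what the constant 3.895 pays for. A vertex of the host has at most a
    proportion q = 11/20 of non-neighbours. Hence a random l-set usually has at
    most a proportion O(q^l) of common non-neighbours, and given this, a second
    random l-set lies among them with probability at most O(q^l)^l. Since
    (13/9)^2 ln (20/11) > 1, this is much smaller than 1/d when d is large. So,
    for all but a tenth of the indices, A i is dominated by K i and K i :|: A i has an
    edge to all other such sets except O(N/d) of them ([random_parts]).

    The embedding. Send the t vertices of H - S injectively and at random to the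
    good indices. The expected number of edges of H - S sent to non-adjacent
    pairs is O(t d * 1/d), with a small constant, so it is less than the number
    of indices that are left over. Each failed edge is repaired by a left over
    index adjacent to both of its ends, which is merged into one of them
    ([repairable_embedding]). Finally every vertex of S is given a hub that
    dominates the whole of U. Such a hub has O(ln t) vertices, and the bound on s
    leaves room for s of them in the host. *)

(** * Minors from branch sets *)

(** This says that the subgraph induced on Z has no disconnecting two-colouring.
    Unlike a definition by paths, this one passes directly to unions and to
    contractions. *)
Definition connected_set (G : sgraph) (Z : {set G}) : Prop :=
  forall P : pred G, {in Z &, forall x y, adj x y -> P x = P y} ->
    {in Z &, forall x y, P x = P y}.

(** The branch set of u is the preimage of Some u, and the vertices sent to None
    are to be deleted. A partial map makes the branch sets disjoint and is easy
    to compose with the maps between a graph and its one-step minors. *)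
Definition minor_model (H G : sgraph) (phi : G -> option H) : Prop :=
  [/\ forall u, exists x, phi x = Some u,
      forall u, connected_set [set x | phi x == Some u] &
      forall u v, adj u v ->
        exists x y, [/\ phi x = Some u, phi y = Some v & adj x y]].

(** Ordered pairs make degrees sum to a count without factors of 2. *)
Definition arcs (G : sgraph) : {set G * G} := [set p | adj p.1 p.2].

Lemma adj_neq (G : sgraph) (x y : G) : adj x y -> x != y.
Proof. by apply: contraTneq => ->; rewrite adj_irrefl. Qed.

Lemma set2_inj (T : finType) (a b x y : T) : a != b ->
  [set a; b] = [set x; y] -> (a, b) = (x, y) \/ (a, b) = (y, x).
Proof.
move=> nab E.
have : a \in [set x; y] by rewrite -E !inE eqxx.
have : b \in [set x; y] by rewrite -E !inE eqxx orbT.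
rewrite !inE => /orP[] /eqP eb /orP[] /eqP ea; subst; rewrite ?eqxx // in nab *.
  by right.
by left.
Qed.

Lemma arcs_delete_edge_lt (G : sgraph) (x y : G) :
  adj x y -> #|arcs (delete_edge x y)| < #|arcs G|.
Proof.
move=> xy; apply: proper_card; apply/properP; split.
  by apply/subsetP=> p; rewrite !inE => /andP[].
by exists (x, y); rewrite inE //= /dele_adj eqxx andbF.
Qed.

Lemma spanning_minor (H G : sgraph) (f : H -> G) :
  bijective f -> (forall u v, adj u v -> adj (f u) (f v)) -> minor H G.
Proof.
move: {2}#|arcs G|.+1 (ltnSn #|arcs G|) => n.
elim: n G f => // n IHn G f; rewrite ltnS => lt_n bij_f hom_f.
have inj_f := bij_inj bij_f.
case: (boolP [exists u, exists v, adj (f u) (f v) && ~~ adj u v]); last first.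
  move=> Hno; apply: minor_iso; exists f => // u v; apply/idP/idP; last exact: hom_f.
  move=> fuv; apply: contraNT Hno => nuv.
  by apply/existsP; exists u; apply/existsP; exists v; rewrite fuv.
case/existsP=> u /existsP[v /andP[fuv nuv]].
apply: (minor_delete_edge fuv); apply: (IHn (delete_edge (f u) (f v)) f) => //.
  exact: leq_trans (arcs_delete_edge_lt fuv) lt_n.
move=> a b ab; rewrite /= /dele_adj hom_f //=; apply: contraNneq nuv => E.
have nab : f a != f b by rewrite (inj_eq inj_f) adj_neq.
by case: (set2_inj nab E) => -[] /inj_f <- /inj_f <- //; rewrite adj_sym.
Qed.

Section Contraction.
Variables (G : sgraph) (x y : G).
Hypothesis xy : adj x y.

Lemma contr_map_neq z : contr_map x y z != y.
Proof.
rewrite /contr_map; case: (eqVneq z y) => // _.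
exact: adj_neq.
Qed.

Definition contr_proj (z : G) : contract_edge x y :=
  Sub (contr_map x y z) (contr_map_neq z).

Lemma contr_projK (z : contract_edge x y) : contr_proj (val z) = z.
Proof. by apply: val_inj; rewrite /= /contr_map (negbTE (valP z)). Qed.

Lemma contr_proj_adj a b :
  adj a b -> contr_proj a != contr_proj b -> adj (contr_proj a) (contr_proj b).
Proof.
move=> ab nab; rewrite /= /contr_adj nab /=.
by apply/existsP; exists a; apply/existsP; exists b; rewrite !eqxx.
Qed.
End Contraction.

(** Delete an unused vertex or contract an edge inside a branch set as long as
    possible; the model survives each step. When neither is possible the
    branch sets are single vertices covering the graph, which is then a
    supergraph of H on the same vertices. *)
Lemma model_minor (H G : sgraph) (phi : G -> option H) :
  minor_model phi -> minor H G.
Proof.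
move: {2}#|G|.+1 (ltnSn #|G|) => n.
elim: n G phi => // n IHn G phi; rewrite ltnS => lt_n [ne conn cross].
case: (boolP [exists z, phi z == None]) => [/existsP[z /eqP phi_z]|total].
  apply: (minor_delete_vertex (v := z)).
  have notz w u : phi w = Some u -> w \notin [set z].
    by rewrite inE => E; apply: contraTneq isT => wz; rewrite wz phi_z in E.
  apply: (IHn _ (fun w : delete_vertices [set z] => phi (val w))).
    rewrite /= card_sig; apply: leq_trans lt_n.
    by apply: proper_card; apply/properP; split;
      [apply/subsetP | exists z; rewrite ?inE ?eqxx].
  split=> [u|u|u v uv].
  - by have [w E] := ne u; exists (Sub w (notz _ _ E)).
  - move=> P edgeP a b; rewrite !inE => Ea Eb.
    pose Q w := if insub w is Some w' then P w' else false.
    have QE (w : delete_vertices [set z]) : Q (val w) = P w by rewrite /Q valK.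
    rewrite -!QE; apply: (conn u); rewrite ?inE //.
    move=> c c'; rewrite !inE => /eqP Ec /eqP Ec' cc'.
    rewrite -[c](SubK (delete_vertices [set z]) (notz _ _ Ec)).
    rewrite -[c'](SubK (delete_vertices [set z]) (notz _ _ Ec')).
    by rewrite !QE; apply: edgeP; rewrite ?inE /= ?Ec ?Ec'.
  - have [a [b [Ea Eb ab]]] := cross u v uv.
    by exists (Sub a (notz _ _ Ea)), (Sub b (notz _ _ Eb)).
have {}total z : exists u, phi z = Some u.
  by case E: (phi z) => [u|]; [exists u | case/existsP: total; exists z; rewrite E].
case: (boolP [exists a, exists b, adj a b && (phi a == phi b)]).
  case/existsP=> x /existsP[y /andP[xy /eqP Exy]].
  have phiE z : phi (contr_map x y z) = phi z.
    by rewrite /contr_map; case: eqVneq => // ->.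
  apply: (minor_contract xy).
  apply: (IHn _ (fun w : contract_edge x y => phi (val w))).
    rewrite /= card_sig; apply: leq_trans lt_n.
    by apply: proper_card; apply/properP; split;
      [apply/subsetP | exists y; rewrite ?inE ?eqxx].
  split=> [u|u|u v uv].
  - by have [w E] := ne u; exists (contr_proj xy w); rewrite /= phiE.
  - move=> P edgeP a b; rewrite !inE => Ea Eb.
    rewrite -(contr_projK xy a) -(contr_projK xy b).
    apply: (conn u (fun w => P (contr_proj xy w))); rewrite ?inE //.
    move=> c c'; rewrite !inE => Ec Ec' cc'.
    have [-> //|ne_cc'] := eqVneq (contr_proj xy c) (contr_proj xy c').
    by apply: edgeP; rewrite ?inE /= ?phiE //; apply: contr_proj_adj.
  - have [a [b [Ea Eb ab]]] := cross u v uv.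
    exists (contr_proj xy a), (contr_proj xy b); rewrite /= !phiE; split=> //.
    apply: (contr_proj_adj (xy := xy)) => //; apply/eqP => E.
    move/(congr1 (fun w : contract_edge x y => phi (val w))): E.
    rewrite /= !phiE Ea Eb => -[E]; move: uv; rewrite E.
    by rewrite adj_irrefl.
move=> noedge.
have inj_phi : injective phi.
  move=> a b; have [u Ea] := total a; rewrite Ea => Eb.
  have := conn u (pred1 a) _ a b; rewrite !inE Ea -Eb eqxx.
  move=> /(_ _ (eqxx _) (eqxx _)) E; apply/eqP; rewrite eq_sym -E //.
  move=> c c'; rewrite !inE => /eqP Ec /eqP Ec' cc'.
  case/existsP: noedge; exists c; apply/existsP; exists c'.
  by rewrite cc' Ec Ec' eqxx.
have [f fE] := fin_all_exists ne.
have [g gE] := fin_all_exists total.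
apply: (spanning_minor (f := f)).
  exists g => [u|z]; first by have := gE (f u); rewrite fE => -[].
  by apply: inj_phi; rewrite fE gE.
move=> u v uv; have [a [b [Ea Eb ab]]] := cross u v uv.
by rewrite (inj_phi (f u) a) ?fE // (inj_phi (f v) b) ?fE.
Qed.

(** * Counting ordered adjacent pairs *)

Lemma card_arcs (G : sgraph) : #|arcs G| = 2 * #|edges G|.
Proof.
rewrite -sum1_card (partition_big (fun p : G * G => [set p.1; p.2]) (mem (edges G))) /=;
  last first.
  case=> x y; rewrite !inE /= => xy.
  by apply/existsP; exists x; apply/existsP; exists y; rewrite xy eqxx.
rewrite mulnC -sum_nat_const; apply: eq_bigr => e.
rewrite inE => /existsP[x /existsP[y /andP[xy /eqP ->]]].
rewrite sum1dep_card.
have -> : [set p | (p \in arcs G) && ([set p.1; p.2] == [set x; y])] = [set (x, y); (y, x)].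
  apply/setP=> -[a b]; rewrite !inE /=; apply/andP/orP => [[ab /eqP E]|].
    by case: (set2_inj (adj_neq ab) E) => ->; rewrite eqxx; [left | right].
  by case=> /eqP[-> ->]; rewrite ?(adj_sym y) xy // setUC.
by rewrite cards2 xpair_eqE (negbTE (adj_neq xy)).
Qed.

Definition degree (G : sgraph) (x : G) := #|[set y | adj x y]|.

Definition codegree (G : sgraph) (x y : G) := #|[set z | adj x z && adj y z]|.

Lemma sum_degree (G : sgraph) : \sum_(x : G) degree x = #|arcs G|.
Proof.
rewrite -sum1_card (partition_big fst predT) //=; apply: eq_bigr => x _.
rewrite /degree -sum1_card.
rewrite (reindex_onto (fun y => (x, y)) snd) /=; last by case=> a b /= /andP[_ /eqP->].
by apply: eq_bigl => y; rewrite !inE /= !eqxx !andbT.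
Qed.

Lemma arcs_delete_edge (G : sgraph) (x y : G) :
  #|arcs G| <= #|arcs (delete_edge x y)| + 2.
Proof.
apply: (@leq_trans #|arcs (delete_edge x y) :|: [set (x, y); (y, x)]|).
  apply: subset_leq_card; apply/subsetP=> -[a b]; rewrite !inE /= /dele_adj => ab.
  rewrite ab /=; case: eqVneq => //= E.
  by case: (set2_inj (adj_neq ab) E) => ->; rewrite eqxx ?orbT.
by apply: leq_trans (leq_card_setU _ _) _; rewrite leq_add2l cards2; case: (_ == _).
Qed.

Lemma arcs_delete_vertex (G : sgraph) (v : G) :
  #|arcs G| <= #|arcs (delete_vertices [set v])| + 2 * degree v.
Proof.
set G' := delete_vertices _.
pose h (p : G' * G') : G * G := (val p.1, val p.2).
have inj_h : injective h by case=> a b [c d] [] /val_inj -> /val_inj ->.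
apply: (@leq_trans #|h @: arcs G' :|: ((fun w => (v, w)) @: [set w | adj v w]
   :|: (fun w => (w, v)) @: [set w | adj v w])|); last first.
  apply: leq_trans (leq_card_setU _ _) _; rewrite card_imset // leq_add2l.
  apply: leq_trans (leq_card_setU _ _) _.
  by rewrite mul2n -addnn leq_add // leq_imset_card.
apply: subset_leq_card; apply/subsetP=> -[a b]; rewrite !inE /= => ab.
have [E|nav] := eqVneq a v.
  by subst; apply/orP; right; apply/orP; left; apply/imsetP; exists b; rewrite ?inE.
have [E|nbv] := eqVneq b v.
  subst; apply/orP; right; apply/orP; right; apply/imsetP; exists a; rewrite ?inE //.
  by rewrite adj_sym.
apply/orP; left; apply/imsetP.
have a' : a \notin [set v] by rewrite inE.
have b' : b \notin [set v] by rewrite inE.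
by exists (Sub a a' : G', Sub b b' : G'); rewrite ?inE.
Qed.

(** The lost pairs are those joining y to x or to a common neighbour of x and y. *)
Lemma arcs_contract (G : sgraph) (x y : G) : adj x y ->
  #|arcs G| <= #|arcs (contract_edge x y)| + 2 * (codegree x y).+1.
Proof.
move=> xy; set G' := contract_edge _ _; set K := [set z | adj x z && adj y z].
pose K1 := x |: K.
pose E := (fun w => (y, w)) @: K1 :|: (fun w => (w, y)) @: K1.
have cardE : #|E| <= 2 * (codegree x y).+1.
  have cK1 : #|K1| <= (codegree x y).+1.
    by rewrite cardsU1; case: (_ \notin _); rewrite //= ?add0n leqW.
  apply: leq_trans (leq_card_setU _ _) _.
  by rewrite mul2n -addnn leq_add //; apply: leq_trans cK1; apply: leq_imset_card.
have swapE a b : ((a, b) \in E) = ((b, a) \in E).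
  rewrite !in_setU orbC; congr (_ || _).
    by apply/imsetP/imsetP => -[w wK [-> ->]]; exists w.
  by apply/imsetP/imsetP => -[w wK [-> ->]]; exists w.
have EP b : adj y b -> (y, b) \notin E -> b != x /\ ~~ adj x b.
  move=> yb nE; apply/andP; rewrite -negb_or; apply: contra nE => nE.
  by rewrite inE; apply/orP; left; apply/imsetP; exists b; rewrite // !inE yb andbT.
(* Outside E, a pair starting at y is sent to a pair (x, b) that was not
   adjacent before, so no pair starting at x has the same image. *)
have start_y a b c d : adj a b -> (a, b) \notin E -> adj c d ->
    contr_map x y a = contr_map x y c -> contr_map x y b = contr_map x y d ->
    a = y -> c = y.
  move=> ab nE cd eac ebd ay; subst a; have [nbx nxb] := EP b ab nE.
  move: eac ebd; rewrite /contr_map eqxx eq_sym in ab *.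
  case: (eqVneq c y) => // _ ec; subst c; rewrite (negbTE (_ : b != y)); last first.
    by rewrite eq_sym adj_neq.
  case: (eqVneq d y) => [_ eb|_ eb]; first by rewrite eb eqxx in nbx.
  by rewrite eb cd in nxb.
pose h (p : G * G) : G' * G' := (contr_proj xy p.1, contr_proj xy p.2).
rewrite -(cardsID E) addnC leq_add //; last first.
  by apply: leq_trans cardE; apply: subset_leq_card; apply: subsetIr.
have hE a b : adj a b -> (a, b) \notin E -> contr_proj xy a != contr_proj xy b.
  move=> ab nE; apply/eqP => /(congr1 val) /=; rewrite /contr_map.
  case: eqVneq => [ea|_]; case: eqVneq => [eb|_] e; subst.
  - by rewrite adj_irrefl in ab.
  - by have [] := EP _ ab nE; rewrite eqxx.
  - by rewrite swapE adj_sym in nE ab; have [] := EP _ ab nE; rewrite eqxx.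
  - by rewrite adj_irrefl in ab.
rewrite -(card_in_imset (f := h)).
  apply: subset_leq_card; apply/subsetP=> q /imsetP[[a b]]; rewrite !inE /= => /andP[nE ab] ->.
  by rewrite /h /=; apply: (contr_proj_adj (xy := xy)) => //; apply: hE; rewrite ?inE.
case=> a b [c d]; rewrite !inE /= -!in_setU => /andP[nE ab] /andP[nE' cd] e.
have e1 : contr_map x y a = contr_map x y c by apply: (congr1 (fun q : G' * G' => val q.1) e).
have e2 : contr_map x y b = contr_map x y d by apply: (congr1 (fun q : G' * G' => val q.2) e).
have inj_y a' c' : (a' = y <-> c' = y) -> contr_map x y a' = contr_map x y c' -> a' = c'.
  rewrite /contr_map; case: (eqVneq a' y) => [->|na]; case: (eqVneq c' y) => [->|nc] // [P Q].
    by move/eqP: nc; case; apply: P.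
  by move/eqP: na; case; apply: Q.
congr (_, _); apply: inj_y => //; split.
- exact: start_y ab nE cd e1 e2.
- by apply: start_y cd nE' ab _ _.
- by rewrite adj_sym swapE in ab nE; rewrite adj_sym in cd; apply: start_y ab nE cd e2 e1.
- by rewrite adj_sym swapE in cd nE'; rewrite adj_sym in ab; apply: start_y cd nE' ab _ _.
Qed.

(** * A dense host *)

(** In a graph where no deletion or contraction preserves the hypothesis, an
    edge xy has at least k common neighbours of its ends, since contracting it
    loses them and xy itself; a vertex has degree more than k, since otherwise
    it could be deleted; and the number of edges is less than k|G| + 1, since
    otherwise an edge could be. The last fact yields a vertex of degree at most
    2k, and its closed neighbourhood is the required set. *)
Lemma dense_nbhd (H : sgraph) (k : nat) : 0 < k ->
  (forall (G : sgraph) (U : {set G}), U != set0 -> #|U| <= 2 * k + 1 ->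
     {in U, forall x, k < #|[set y in U | adj x y]|} -> minor H G) ->
  forall G : sgraph, 0 < #|G| -> 2 * k * #|G| <= #|arcs G| -> minor H G.
Proof.
move=> k_gt0 base G.
move: {2}#|G| (leqnn #|G|) => n; elim: n G => [|n IHn] G.
  by rewrite leqn0 => /eqP->.
move: {2}#|arcs G| (leqnn #|arcs G|) => m; elim: m G => [|m IHm] G le_m le_n G_gt0 dense.
  by exfalso; nia.
have [[a b]] : exists p, p \in arcs G by apply/card_gt0P; nia.
rewrite inE /= => ab.
have nab : a != b by apply: contraTneq ab => ->; rewrite adj_irrefl.
have G_gt1 : 1 < #|G|.
  by rewrite -cardsT; apply: leq_trans (subset_leq_card (subsetT [set a; b])); rewrite cards2 nab.
case: (boolP [exists v : G, degree v <= k]) => [/existsP[v dv]|/existsPn deg_gt].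
  have card' : #|delete_vertices [set v]| = #|G|.-1.
    rewrite card_sig -(cardC1 v); apply: eq_card => u; by rewrite !inE.
  apply: (minor_delete_vertex (v := v)); apply: IHn; rewrite ?card'; try lia.
  by have := arcs_delete_vertex v; nia.
case: (boolP [exists x : G, exists y : G, adj x y && (codegree x y < k)]).
  case/existsP=> x /existsP[y /andP[xy cxy]].
  have card' : #|contract_edge x y| = #|G|.-1.
    by rewrite card_sig -(cardC1 y); apply: eq_card => u; rewrite !inE.
  apply: (minor_contract xy); apply: IHn; rewrite ?card'; try lia.
  by have := arcs_contract xy; nia.
move=> codeg_ge.
case: (leqP (2 * k * #|G| + 2) #|arcs G|) => [big|tight].
  apply: (minor_delete_edge ab); apply: IHm => //.
    by have := arcs_delete_edge_lt ab; lia.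
  by have := arcs_delete_edge a b; rewrite -[#|delete_edge a b|]/#|G|; lia.
have [v dv] : exists v : G, degree v <= 2 * k.
  apply/existsP; apply: contraLR tight => /existsPn big; rewrite -leqNgt -sum_degree.
  apply: (@leq_trans (\sum_(v : G) (2 * k).+1)).
    have -> : \sum_(v : G) (2 * k).+1 = #|G| * (2 * k).+1 by rewrite sum_nat_const.
    nia.
  by apply: leq_sum => v _; rewrite ltnNge big.
apply: (base G (v |: [set y | adj v y])).
- by apply/set0Pn; exists v; rewrite !inE eqxx.
- by rewrite cardsU1 -/(degree v); case: (_ \notin _) => /=; lia.
- move=> x; rewrite !inE => /orP[/eqP->|vx].
    have := deg_gt v; rewrite -ltnNge => /leq_trans -> //.
    by apply: subset_leq_card; apply/subsetP=> y; rewrite !inE => ->; rewrite orbT.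
  apply: (@leq_trans #|v |: [set z | adj v z && adj x z]|).
    rewrite cardsU1 inE adj_irrefl /= -/(codegree v x) add1n ltnS leqNgt.
    by apply: contra codeg_ge => c; apply/existsP; exists v; apply/existsP; exists x; rewrite vx.
  apply: subset_leq_card; apply/subsetP=> y; rewrite !inE.
  by case/orP=> [/eqP->|/andP[-> ->]]; rewrite ?eqxx ?orbT //= adj_sym vx.
Qed.

Lemma connected_set1 (G : sgraph) (x : G) : connected_set [set x].
Proof. by move=> P _ a b; rewrite !inE => /eqP-> /eqP->. Qed.

Lemma connected_setU (G : sgraph) (A B : {set G}) (x : G) :
  x \in A -> x \in B -> connected_set A -> connected_set B -> connected_set (A :|: B).
Proof.
move=> xA xB cA cB P edgeP.
have HA : {in A, forall y, P y = P x}.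
  move=> y yA; apply: cA => // c d cAc dA; apply: edgeP; by rewrite inE ?cAc ?dA.
have HB : {in B, forall y, P y = P x}.
  move=> y yB; apply: cB => // c d cAc dA; apply: edgeP; by rewrite inE ?cAc ?dA orbT.
by move=> a b; rewrite !inE => /orP[/HA|/HB] -> /orP[/HA|/HB] ->.
Qed.

Lemma connected_setU1 (G : sgraph) (A : {set G}) (x y : G) :
  x \in A -> adj x y -> connected_set A -> connected_set (y |: A).
Proof.
move=> xA xy cA P edgeP.
have HA : {in A, forall z, P z = P x}.
  move=> z zA; apply: cA => // c d cAc dA; apply: edgeP; by rewrite !inE ?cAc ?dA orbT.
have yx : P y = P x by apply/esym/edgeP => //; rewrite !inE ?eqxx ?xA ?orbT.
by move=> a b; rewrite !inE => /orP[/eqP->|/HA->] /orP[/eqP->|/HA->]; rewrite ?yx.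
Qed.

Lemma connected_setU_adj (G : sgraph) (A B : {set G}) (x y : G) :
  x \in A -> y \in B -> adj x y -> connected_set A -> connected_set B ->
  connected_set (A :|: B).
Proof.
move=> xA yB xy cA cB.
suff -> : A :|: B = (y |: A) :|: B.
  by apply: (connected_setU (x := y)) (connected_setU1 xA xy cA) cB; rewrite // !inE eqxx.
by apply/setP=> z; rewrite !inE; case: eqVneq => // ->; rewrite yB orbT.
Qed.

(** A robust form of bounded diameter: it lets one connect vertices again and
    again while keeping the connections disjoint. *)
Definition linked (G : sgraph) (U : {set G}) (kap : nat) : Prop :=
  forall X : {set G}, #|X| <= kap -> {in U :\: X &, forall u v,
    exists Z : {set G}, [/\ Z \subset U :\: X, u \in Z, v \in Z, connected_set Z & #|Z| <= 6]}.

Section Ball.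
Variables (G : sgraph) (V : {set G}).

Definition expand (A : {set G}) := [set x in V | [exists y in A, (x == y) || adj x y]].

Lemma expand_sub A : expand A \subset V.
Proof. by apply/subsetP=> x; rewrite inE => /andP[]. Qed.

Lemma expand_mono (A : {set G}) x : x \in V -> x \in A -> x \in expand A.
Proof. by move=> xV xA; rewrite inE xV; apply/existsP; exists x; rewrite xA eqxx. Qed.

Lemma expand_path (A : {set G}) n x :
  (forall a, a \in A -> exists Z : {set G}, [/\ Z \subset V, x \in Z, a \in Z, connected_set Z & #|Z| <= n]) ->
  forall a, a \in expand A -> exists Z : {set G}, [/\ Z \subset V, x \in Z, a \in Z, connected_set Z & #|Z| <= n.+1].
Proof.
move=> IH a; rewrite inE => /andP[aV /existsP[b /andP[bA ab]]].
have [Z [ZV xZ bZ cZ sZ]] := IH b bA.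
exists (a |: Z); split.
- by rewrite subUset sub1set aV.
- by rewrite !inE xZ orbT.
- by rewrite !inE eqxx.
- case/orP: ab => [/eqP->|ab]; last by apply: (connected_setU1 bZ); rewrite // adj_sym.
  by rewrite (setUidPr _) // sub1set.
- by rewrite cardsU1; case: (_ \notin _) => /=; lia.
Qed.
End Ball.

(** If u and v cannot be joined outside X, then their balls of radius 2 in U :\: X
    are disjoint with no edge between them. They cover U :\: X, as a vertex
    outside both would have a neighbourhood disjoint from those of u and v,
    which is impossible: three disjoint neighbourhoods have about 3k > |U|
    vertices. The smaller ball has at most k vertices and loses to X only kap of
    the k neighbours of each of its vertices. So in it any two vertices have
    most vertices as common neighbours, and it is linked. *)
Lemma link_dichotomy (G : sgraph) (U : {set G}) (k kap : nat) :
  0 < k -> 20 * kap <= k -> U != set0 -> #|U| <= 2 * k + 1 ->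
  {in U, forall x, k < #|[set y in U | adj x y]|} ->
  exists U' : {set G}, [/\ U' != set0, #|U'| <= 2 * k + 1,
    {in U', forall x, k - kap <= #|[set y in U' | adj x y]|} & linked U' kap].
Proof.
move=> k_gt0 kk U0 sU degU.
pose B (X : {set G}) u := expand (U :\: X) (expand (U :\: X) [set u]).
pose far X u v := [forall x in B X u, forall y in B X v, (x != y) && ~~ adj x y].
case: (boolP [exists X : {set G}, (#|X| <= kap) &&
   [exists u in U :\: X, exists v in U :\: X, far X u v]]); last first.
  move=> Hno; exists U; split=> //.
    by move=> x xU; apply: leq_trans (leq_subr _ _) _; apply/ltnW/degU.
  move=> X sX u v uV vV.
  have /forall_inPn[x xu /forall_inPn[y yv]] : ~~ far X u v.
    apply: contra Hno => f; apply/existsP; exists X; rewrite sX.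
    by apply/existsP; exists u; rewrite uV; apply/existsP; exists v; rewrite vV.
  rewrite negb_and !negbK => xy.
  have start w : w \in U :\: X -> forall a, a \in [set w] -> exists Z : {set G},
     [/\ Z \subset U :\: X, w \in Z, a \in Z, connected_set Z & #|Z| <= 1].
    move=> wV a; rewrite inE => /eqP->; exists [set w].
    by rewrite sub1set wV !inE eqxx cards1; split=> //; apply: connected_set1.
  have [Z1 [Z1V uZ1 xZ1 cZ1 sZ1]] := expand_path (expand_path (start u uV)) xu.
  have [Z2 [Z2V vZ2 yZ2 cZ2 sZ2]] := expand_path (expand_path (start v vV)) yv.
  exists (Z1 :|: Z2); split.
  - by rewrite subUset Z1V.
  - by rewrite inE uZ1.
  - by rewrite inE vZ2 orbT.
  - case/orP: xy => [/eqP e|xy]; first by subst; apply: (connected_setU xZ1).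
    exact: (connected_setU_adj xZ1 yZ2).
  - by apply: leq_trans (leq_card_setU _ _) (leq_add sZ1 sZ2).
(* From here on, the balls of radius 2 about u and v in U :\: X are disjoint and
   have no edge between them. *)
case/existsP=> X /andP[sX /existsP[u /andP[uV /existsP[v /andP[vV /forall_inP farP]]]]].
have {}farP x y : x \in B X u -> y \in B X v -> x != y /\ ~~ adj x y.
  by move=> xu yv; have /forall_inP/(_ y yv)/andP[] := farP x xu.
pose V := U :\: X.
pose N w := [set y in V | adj w y].
have NE w y : (y \in N w) = (y \in V) && adj w y by rewrite inE.
have BE z y w : w \in V -> y \in V -> z \in V -> adj z y -> adj w y -> w \in B X z.
  move=> wV yV zV zy wy; rewrite inE wV; apply/existsP; exists y; rewrite wy orbT andbT inE.
  by apply/andP; split=> //; apply/existsP; exists z; rewrite inE eqxx adj_sym zy orbT.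
have degV w : w \in U -> k - kap < #|N w|.
  move=> wU; have := degU w wU.
  have : #|[set y in U | adj w y]| <= #|N w| + #|X|.
    apply: leq_trans (leq_card_setU _ _); apply: subset_leq_card.
    by apply/subsetP=> y; rewrite !inE; case: (y \in X) => //=; rewrite orbF.
  lia.
have VU : V \subset U by apply: subsetDl.
have cover w : w \in V -> (w \in B X u) || (w \in B X v).
  move=> wV; apply/norP=> -[wu wv].
  have ne z : z \in V -> w \notin B X z -> [disjoint N w & N z].
    move=> zV nz; rewrite disjoint_sym -setI_eq0; apply: contraR nz => /set0Pn[y /setIP[]].
    by rewrite !NE => /andP[yV zy] /andP[_ wy]; apply: (BE z y w).
  have nuv : [disjoint N u & N v].
    rewrite -setI_eq0; apply/negPn/negP=> /set0Pn[y /setIP[]].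
    rewrite !NE => /andP[yV uy] /andP[_ vy].
    have yB z : z \in V -> adj z y -> y \in B X z.
      move=> zV zy; apply: expand_mono => //.
      by rewrite inE; apply/andP; split=> //; apply/existsP; exists z; rewrite inE eqxx adj_sym zy orbT.
    by have [] := farP y y (yB u uV uy) (yB v vV vy); rewrite eqxx.
  have : #|N w :|: (N u :|: N v)| <= #|U|.
    by apply: subset_leq_card; rewrite !subUset !(subset_trans _ VU) //;
      apply/subsetP=> y; rewrite inE => /andP[].
  rewrite cardsU disjoint_setI0 ?cards0; last first.
    by rewrite disjoints_subset setCU subsetI -!disjoints_subset !ne.
  rewrite cardsU (disjoint_setI0 nuv) cards0.
  have := degV w (subsetP VU _ wV); have := degV u (subsetP VU _ uV).
  have := degV v (subsetP VU _ vV); lia.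
have [P [PV P0 sP closed]] : exists P : {set G}, [/\ P \subset V, P != set0, #|P| <= k &
   forall x y, x \in P -> y \in V -> adj x y -> y \in P].
  have BV z : B X z \subset V by apply: expand_sub.
  have Bz z : z \in V -> B X z != set0.
    by move=> zV; apply/set0Pn; exists z; do 2!apply: expand_mono => //; rewrite inE.
  have : #|B X u :|: B X v| <= #|U|.
    by apply: subset_leq_card; rewrite subUset !(subset_trans (BV _) VU).
  rewrite cardsU disjoint_setI0 ?cards0; last first.
    rewrite -setI_eq0; apply/negPn/negP=> /set0Pn[y]; rewrite inE => /andP[yu yv].
    by have [] := farP y y yu yv; rewrite eqxx.
  move=> sB; case: (leqP #|B X u| k) => [le_k|gt_k].
    exists (B X u); split=> //; first exact: Bz.
    move=> x y xB yV xy; have /orP[//|yB] := cover y yV.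
    by have [_] := farP x y xB yB; rewrite xy.
  exists (B X v); split=> //; [exact: Bz | by lia | ].
  move=> x y xB yV xy; have /orP[yB|//] := cover y yV.
  by have [_] := farP y x yB xB; rewrite adj_sym xy.
have degP x : x \in P -> k - kap < #|[set y in P | adj x y]|.
  move=> xP; apply: leq_trans (degV x (subsetP VU _ (subsetP PV _ xP))) _.
  apply: subset_leq_card; apply/subsetP=> y; rewrite !inE => /andP[yV xy].
  by rewrite xy andbT (closed x) // /V inE.
exists P; split=> //; first by apply: leq_trans sP _; rewrite mul2n -addnn -addnA leq_addr.
  by move=> x xP; apply/ltnW/degP.
move=> Y sY a b; rewrite [a \in _]inE [b \in _]inE => /andP[aY aP] /andP[bY bP].
pose M z := [set y in P :\: Y | adj z y].
have degM z : z \in P -> k - kap - kap < #|M z|.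
  move=> zP; have := degP z zP.
  have : #|[set y in P | adj z y]| <= #|M z| + #|Y|.
    apply: leq_trans (leq_card_setU _ _); apply: subset_leq_card.
    by apply/subsetP=> y; rewrite !inE; case: (y \in Y) => //=; rewrite orbF.
  by move: sY kk; move: #|M z| #|[set y in P | _]| #|Y|; clear; lia.
have [z] : exists z, z \in M a :&: M b.
  apply/set0Pn; rewrite -card_gt0.
  have : #|M a :|: M b| <= #|P|.
    apply: subset_leq_card; apply/subsetP=> y; rewrite !inE.
    by case/orP=> /andP[/andP[]].
  rewrite cardsU; have := degM a aP; have := degM b bP.
  have : #|M a :&: M b| <= #|M a| by apply/subset_leq_card/subsetIl.
  move: sP kk k_gt0; move: #|P| #|M a| #|M b| #|M a :&: M b|; clear; lia.
rewrite !inE => /andP[/andP[/andP[zY zP] az] /andP[_ bz]].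
exists (b |: (z |: [set a])); split.
- by rewrite !subUset !sub1set !inE aY aP bY bP zY zP.
- by rewrite !inE eqxx !orbT.
- by rewrite !inE eqxx.
- apply: (@connected_setU1 _ _ z); rewrite ?inE ?eqxx //; first by rewrite adj_sym.
  apply: (@connected_setU1 _ _ a); rewrite ?inE ?eqxx //; exact: connected_set1.
- by rewrite cardsU1 cardsU1 cards1; case: (_ \notin _); case: (_ \notin _).
Qed.

(** * Hubs *)

Lemma card_bigcup_ord (T : finType) (N b : nat) (K : nat -> {set T}) :
  (forall i, i < N -> #|K i| <= b) -> #|\bigcup_(i < N) K i| <= N * b.
Proof.
move=> leb; apply: (@leq_trans (\sum_(i < N) #|K i|)).
  elim/big_rec2: _ => [|i m A _ IH]; first by rewrite cards0.
  by apply: leq_trans (leq_card_setU _ _) _; rewrite leq_add2l.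
rewrite -[in leqRHS](card_ord N) -sum_nat_const.
by apply: leq_sum => i _; apply: leb.
Qed.

Definition undominated (G : sgraph) (U K : {set G}) :=
  [set y in U | ~~ [exists x in K, adj x y]].

Section Hubs.
Variables (G : sgraph) (U : {set G}) (k kap : nat).
Hypotheses (k_ge : 5 <= k) (kap_le : 20 * kap <= k) (U_ne : U != set0).
Hypothesis sU : #|U| <= 2 * k + 1.
Hypothesis degU : {in U, forall x, k - kap <= #|[set y in U | adj x y]|}.
Hypothesis linkU : linked U kap.

(** Every vertex of Y has at least k - 2 kap neighbours outside X, which is more
    than 2/5 of |U|; so the average vertex outside X is adjacent to that
    proportion of Y. *)
Lemma popular_vertex (X Y : {set G}) : #|X| <= kap -> Y \subset U ->
  exists2 v, v \in U :\: X & 2 * #|Y| <= 5 * #|[set y in Y | adj v y]|.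
Proof.
move=> sX YU.
have degD y : y \in U -> k - 2 * kap <= #|[set v in U :\: X | adj v y]|.
  move=> yU; have := degU yU.
  have : #|[set v in U | adj y v]| <= #|[set v in U :\: X | adj v y]| + #|X|.
    apply: leq_trans (leq_card_setU _ _); apply: subset_leq_card.
    by apply/subsetP=> z; rewrite !inE [adj y z]adj_sym; case: (z \in X) => //=; rewrite orbF.
  lia.
have [Y0|Y_ne] := posnP #|Y|.
  have [y yU] := set0Pn _ U_ne.
  have /card_gt0P[v] : 0 < #|[set v in U :\: X | adj v y]|.
    by apply: leq_trans (degD y yU); lia.
  by rewrite inE => /andP[vV _]; exists v => //; rewrite Y0.
case: (boolP [exists v in U :\: X, 2 * #|Y| <= 5 * #|[set y in Y | adj v y]|]).
  by case/exists_inP=> v; exists v.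
move/exists_inPn => few; exfalso.
have count : \sum_(v in U :\: X) #|[set y in Y | adj v y]| =
             \sum_(y in Y) #|[set v in U :\: X | adj v y]|.
  rewrite (eq_bigr (fun v => \sum_(y in Y) (adj v y : nat))); last first.
    move=> v _; rewrite -sum1_card big_mkcond [RHS]big_mkcond; apply: eq_bigr => y _.
    by rewrite !inE; case: (y \in Y); case: (adj v y).
  rewrite exchange_big; apply: eq_bigr => y _.
  rewrite -sum1_card big_mkcond [RHS]big_mkcond; apply: eq_bigr => v _.
  by rewrite inE; case: (v \in _); case: (adj v y).
have lower : (k - 2 * kap) * #|Y| <= \sum_(y in Y) #|[set v in U :\: X | adj v y]|.
  rewrite mulnC -sum_nat_const; apply: leq_sum => y yY.
  exact/degD/(subsetP YU).
have upper : 5 * \sum_(v in U :\: X) #|[set y in Y | adj v y]| <= (2 * #|Y|) * #|U|.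
  rewrite big_distrr /=; apply: (@leq_trans (\sum_(v in U :\: X) 2 * #|Y|)).
    by apply: leq_sum => v vV; apply: ltnW; rewrite ltnNge few.
  by rewrite sum_nat_const mulnC leq_mul2l subset_leq_card ?orbT // subsetDl.
move: upper lower; rewrite count; move: (\sum_(_ in _) _) => Sg up lo.
have gap : 4 * k + 3 <= 5 * (k - 2 * kap) by lia.
have := leq_mul (leqnn #|Y|) gap; have := leq_mul (leqnn #|Y|) sU; move: up lo Y_ne.
by move: #|Y| #|U| (k - 2 * kap) => y u g; clear; lia.
Qed.

(** Each round adds a vertex that dominates 2/5 of what is not yet dominated, and
    at most four more vertices to attach it to the part already built. *)
Lemma hub (X : {set G}) (r : nat) : #|X| <= kap ->
  exists K : {set G}, [/\ K \subset U :\: X, K != set0, connected_set K, #|K| <= 6 * r + 1 &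
    5 ^ r * #|undominated U K| <= 3 ^ r * #|U|].
Proof.
move=> sX; elim: r => [|r [K [KV K0 cK sK domK]]].
  have [v vV _] := popular_vertex sX (sub0set U).
  exists [set v]; rewrite sub1set cards1 !expn0 !mul1n; split=> //.
  - by apply/set0Pn; exists v; rewrite inE.
  - exact: connected_set1.
  - by apply/subset_leq_card/subsetP=> y; rewrite inE => /andP[].
have YU : undominated U K \subset U by apply/subsetP=> y; rewrite inE => /andP[].
have [v vV pop] := popular_vertex sX YU.
have [w wK] := set0Pn _ K0.
have [Z [ZV vZ wZ cZ sZ]] := linkU sX vV (subsetP KV _ wK).
exists (K :|: Z); split.
- by rewrite subUset KV.
- by apply/set0Pn; exists w; rewrite inE wK.
- exact: (connected_setU wK).
- by apply: leq_trans (leq_card_setU _ _) _; apply: leq_trans (leq_add sK sZ) _; lia.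
have : #|undominated U (K :|: Z)| + #|[set y in undominated U K | adj v y]| <= #|undominated U K|.
  rewrite -cardsUI [X in _ + X]eq_card0 ?addn0.
    apply: subset_leq_card; apply/subsetP=> y; rewrite inE => /orP[|]; last first.
      by rewrite inE => /andP[].
    rewrite !inE => /andP[-> H]; apply: contra H => /exists_inP[x xK xy].
    by apply/exists_inP; exists x; rewrite // inE xK.
  move=> y; rewrite !inE; apply/negP=> /andP[/andP[_ /exists_inP H] /andP[_ vy]].
  by apply: H; exists v; rewrite // inE vZ orbT.
move=> split_le; have drop : 5 * #|undominated U (K :|: Z)| <= 3 * #|undominated U K|.
  move: split_le pop; move: #|undominated U (K :|: Z)| #|undominated U K|; clear.
  by move=> u' u; lia.
have := leq_mul (leqnn (5 ^ r)) drop; have := leq_mul (leqnn 3) domK; rewrite !expnS.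
move: #|undominated U (K :|: Z)| #|undominated U K| #|U| (5 ^ r) (3 ^ r); clear.
by move=> u' u n f g; lia.
Qed.

Lemma hubs (X : {set G}) (r N : nat) : #|X| + N * (6 * r + 1) <= kap ->
  exists K : nat -> {set G},
    (forall i, i < N -> [/\ K i \subset U :\: X, K i != set0, connected_set (K i),
        #|K i| <= 6 * r + 1 & 5 ^ r * #|undominated U (K i)| <= 3 ^ r * #|U|]) /\
    (forall i j, i < N -> j < N -> i != j -> [disjoint K i & K j]).
Proof.
elim: N => [|N IHN] le_kap; first by exists (fun=> set0).
have [|K [propK disK]] := IHN; first by apply: leq_trans le_kap; rewrite leq_add2l leq_mul2r leqnSn orbT.
pose X' := X :|: \bigcup_(i < N) K i.
have sX' : #|X'| <= kap.
  apply: leq_trans le_kap; apply: leq_trans (leq_card_setU _ _) _; rewrite leq_add2l.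
  apply: leq_trans (_ : N * (6 * r + 1) <= _); last by rewrite leq_mul2r leqnSn orbT.
  by apply: card_bigcup_ord => i iN; case: (propK i iN).
have [L [LV L0 cL sL domL]] := hub r sX'.
have LK i : i < N -> [disjoint L & K i].
  move=> iN; rewrite disjoint_sym -setI_eq0 -subset0; apply/subsetP=> z; rewrite inE => /andP[zK zL].
  have := subsetP LV _ zL; rewrite !inE negb_or => /andP[/andP[_ /bigcupP out] _]; case: out.
  by exists (Ordinal iN).
exists (fun i => if i == N then L else K i); split=> [i|i j].
  rewrite ltnS leq_eqVlt; case: eqVneq => [_ _|_ /= iN]; last exact: propK.
  split=> //; apply: subset_trans LV _; apply: setDS; exact: subsetUl.
rewrite !ltnS (leq_eqVlt i) (leq_eqVlt j); case: (eqVneq i N) => [->|_] /=; case: (eqVneq j N) => [->|_] //=.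
- by move=> _ jN _; apply: LK.
- by move=> iN _ _; rewrite disjoint_sym LK.
- exact: disK.
Qed.
End Hubs.
(** * Random permutations *)

Lemma card_permT (T : finType) : #|{: {perm T}}| = #|T|`!.
Proof.
rewrite -[#|T|]cardsT -card_perm; apply: eq_card => s; rewrite [RHS]unfold_in.
by apply/esym/subsetP=> z _; rewrite inE.
Qed.

Section PermExchange.
Variables (T : finType) (X : {set T}) (B : {perm T} -> {set T}) (b : nat).
Hypothesis B_le : forall s, #|B s| <= b.
(* B s depends only on the restriction of s to X: permutations are composed from
   left to right, so that tperm y z * s exchanges the values of s at y and z. *)
Hypothesis B_inv : forall s y z, y \notin X -> z \notin X -> B (tperm y z * s)%g = B s.

Definition all_in (Y : {set T}) (s : {perm T}) := [forall y in Y, s y \in B s].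

(** Exchanging the values at x and at another point y outside X and Y shows that
    s y is as likely as s x to lie in B s. Summing over y counts the elements of
    B s, at most b of them. *)
Lemma perm_exchange_step (Y : {set T}) (x : T) :
  [disjoint X & Y] -> x \notin X -> x \notin Y ->
  #|all_in (x |: Y)| * (#|T| - #|X| - #|Y|) <= #|all_in Y| * b.
Proof.
move=> XY xX xY; set F := ~: (X :|: Y).
have cF : #|F| = #|T| - #|X| - #|Y|.
  have := cardsC (X :|: Y); rewrite -/F cardsU disjoint_setI0 // cards0; lia.
have swap y : y \in F -> #|all_in (x |: Y)| = \sum_(s | all_in Y s) (s y \in B s).
  rewrite !inE negb_or => /andP[yX yY].
  rewrite -sum1_card big_mkcond [RHS]big_mkcond /= (reindex_inj (mulgI (tperm x y))).
  apply: eq_bigr => s _.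
  have fixY z : z \in Y -> (tperm x y * s)%g z = s z.
    move=> zY; rewrite permM tpermD //.
      by apply: contraNneq xY => ->.
    by apply: contraNneq yY => ->.
  have -> : ((tperm x y * s)%g \in all_in (x |: Y)) = all_in Y s && (s y \in B s).
    rewrite -[LHS]/(all_in (x |: Y) (tperm x y * s)%g) /all_in B_inv //; apply/forall_inP/andP.
      move=> H; split; last by rewrite -[y in s y](tpermL x y) -permM H // !inE eqxx.
      by apply/forall_inP=> z zY; rewrite -fixY // H // !inE zY orbT.
    case=> /forall_inP H sy z; rewrite !inE => /orP[/eqP->|zY].
      by rewrite permM tpermL.
    by rewrite fixY // H.
  by case: (all_in Y s) => //=; case: (_ \in _).
rewrite -cF mulnC -sum_nat_const (eq_bigr _ swap) exchange_big /=.
rewrite -[in leqRHS]sum1_card big_distrl /= leq_sum // => s _.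
rewrite mul1n -big_mkcondr /= sum1_card -(card_imset _ (@perm_inj _ s)).
apply: leq_trans (B_le s); apply: subset_leq_card.
by apply/subsetP=> z /imsetP[y]; rewrite unfold_in => /andP[_ ?] ->.
Qed.

(** In a uniformly random permutation, the values on Y behave as if each of them
    fell into B s with conditional probability at most b / (|T| - |X| - |Y|). *)
Lemma perm_exchange (Y : {set T}) : [disjoint X & Y] ->
  #|all_in Y| * (#|T| - #|X| - #|Y|) ^ #|Y| <= #|T|`! * b ^ #|Y|.
Proof.
move: {2}#|Y| (erefl #|Y|) => n En.
suff H (Z : {set T}) : [disjoint X & Z] -> #|Z| <= #|Y| ->
    #|all_in Z| * (#|T| - #|X| - #|Y|) ^ #|Z| <= #|T|`! * b ^ #|Z| by move/H; apply.
move: {2}#|Z| (erefl #|Z|) => k; elim: k Z => [|k IHk] Z Ek XZ leZ.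
  by rewrite Ek !expn0 !muln1 -card_permT max_card.
have /card_gt0P[x xZ] : 0 < #|Z| by rewrite Ek.
have xX : x \notin X by rewrite (disjointFl XZ).
pose Z' := Z :\ x.
have EZ : Z = x |: Z' by rewrite setD1K.
have cZ' : #|Z'| = k by have := cardsD1 x Z; rewrite xZ -/Z'; lia.
have XZ' : [disjoint X & Z'] by apply: disjointWr XZ; apply: subD1set.
have xZ' : x \notin Z' by rewrite !inE eqxx.
have := perm_exchange_step XZ' xX xZ'; rewrite -EZ => step.
have := IHk Z' cZ' XZ'; rewrite cZ' => /(_ ltac:(lia)) IH.
rewrite Ek !expnS mulnA.
apply: (@leq_trans (#|all_in Z'| * b * (#|T| - #|X| - #|Y|) ^ k)).
  rewrite leq_mul2r; apply/orP; right; apply: leq_trans step; rewrite leq_mul2l.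
  by apply/orP; right; lia.
have := leq_mul (leqnn b) IH.
move: (_ ^ k) (b ^ k) (_`!) => p q f; lia.
Qed.
End PermExchange.
(** * Embedding in an almost complete auxiliary graph *)

Lemma greedy_sdr (A B : finType) (b0 : B) (P : {set A}) (F : A -> {set B}) :
  {in P, forall a, #|P| <= #|F a|} ->
  exists2 g : A -> B, {in P &, injective g} & {in P, forall a, g a \in F a}.
Proof.
move: {2}#|P| (leqnn #|P|) => n; elim: n P => [|n IHn] P.
  rewrite leqn0 cards_eq0 => /eqP-> _; exists (fun=> b0) => a; by rewrite inE.
move=> le_n big; have [P0|[a aP]] := set_0Vmem P.
  by exists (fun=> b0) => a; rewrite P0 inE.
have cP := cardsD1 a P; rewrite aP add1n in cP.
have [|a' /setD1P[_ a'P]|g inj_g gF] := IHn (P :\ a); first by rewrite -ltnS -cP.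
  by apply: leq_trans (big a' a'P); rewrite cP.
have [b] : exists b, b \in F a :\: g @: (P :\ a).
  apply/set0Pn; rewrite -card_gt0 cardsD subn_gt0; apply: leq_trans (big a aP); rewrite cP.
  by rewrite ltnS; apply: leq_trans (leq_imset_card g _); apply/subset_leq_card/subsetIr.
rewrite inE => /andP[new bF].
exists (fun x => if x == a then b else g x) => [x y xP yP|x xP]; last first.
  by case: eqVneq => [->|nx] //; apply: gF; rewrite !inE nx.
case: (eqVneq x a) => [->|nx]; case: (eqVneq y a) => [->|ny] // E.
- by case/negP: new; rewrite E; apply: imset_f; rewrite !inE ny.
- by case/negP: new; rewrite -E; apply: imset_f; rewrite !inE nx.
- by apply: inj_g => //; rewrite !inE ?nx ?ny.
Qed.

Lemma exists_le_sum (F : finType) (f : F -> nat) (c : nat) :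
  0 < #|F| -> \sum_x f x <= #|F| * c -> exists x, f x <= c.
Proof.
move=> F_gt0 le_c; apply/existsP; apply: contraLR le_c => /existsPn big.
rewrite -ltnNge; apply: (@leq_trans (#|F| * c.+1)); first by rewrite ltn_mul2l F_gt0 /=.
by rewrite -sum_nat_const; apply: leq_sum => x _; rewrite ltnNge big.
Qed.

(** The graph h on V is to be embedded in the indices of J, of which na relates
    the non-adjacent ones. *)
Section RepairableEmbedding.
Variables (V I : finType) (h : rel V) (na : rel I) (J : {set I}) (c b : nat).
Hypothesis h_irr : irreflexive h.
Hypothesis na_deg : {in J, forall i, #|[set j in J | (j != i) && na i j]| <= c}.
Hypothesis few_bad : #|[set p : V * V | h p.1 p.2]| * c <= b * (#|V| - 2).
Hypotheses (V_big : 2 < #|V|) (J_big : #|V| + b + 2 * c <= #|J|).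

(** For a random embedding, an edge of h is sent to a non-adjacent pair with
    probability at most c / (|V| - 2), so that b bounds the expected number of
    such edges. *)
Lemma few_bad_embedding : exists f : V -> I,
  [/\ injective f, forall v, f v \in J &
      #|[set p | h p.1 p.2 && na (f p.1) (f p.2)]| <= b].
Proof.
have le_VJ : #|V| <= #|J| by lia.
pose f0 (v : V) := enum_val (widen_ord le_VJ (enum_rank v)).
have f0J v : f0 v \in J by apply: enum_valP.
have inj_f0 : injective f0.
  by move=> u v /enum_val_inj /(congr1 val) /= /val_inj /enum_rank_inj.
suff [s s_le] : exists s : {perm V},
    #|[set p | h p.1 p.2 && na (f0 (s p.1)) (f0 (s p.2))]| <= b.
  by exists (f0 \o s); split=> //=; apply: inj_comp => //; apply: perm_inj.
pose E := [set p : V * V | h p.1 p.2].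
have pairP (u v : V) : h u v ->
    #|[set s : {perm V} | na (f0 (s u)) (f0 (s v))]| * (#|V| - 2) <= #|V|`! * c.
  move=> huv; have nuv : u != v by apply: contraTneq huv => ->; rewrite h_irr.
  pose B (s : {perm V}) := [set w | (w != s u) && na (f0 (s u)) (f0 w)].
  have := @perm_exchange _ [set u] B c _ _ [set v].
  rewrite !cards1 !expn1 -subnDA => H; apply: leq_trans (H _ _ _).
  - rewrite leq_mul2r; apply/orP; right; apply: subset_leq_card; apply/subsetP=> s.
    rewrite inE => nas; rewrite unfold_in; apply/forall_inP=> w; rewrite inE => /eqP->.
    by rewrite inE nas andbT (inj_eq perm_inj) eq_sym.
  - move=> s; rewrite -(card_imset _ inj_f0); apply: leq_trans (na_deg (f0J (s u))).
    apply: subset_leq_card; apply/subsetP=> i /imsetP[w]; rewrite [w \in _]inE => /andP[nw naw] ->.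
    by rewrite inE f0J naw (inj_eq inj_f0) nw.
  - move=> s y z; rewrite !inE => yu zu; apply/setP=> w.
    by rewrite !inE permM tpermD.
  - by rewrite disjoints1 inE.
apply: exists_le_sum; rewrite card_permT ?fact_gt0 //.
have pos : 0 < #|V| - 2 by lia.
rewrite -(leq_pmul2r pos).
apply: (@leq_trans (\sum_(p in E) #|V|`! * c)); last first.
  by rewrite sum_nat_const mulnCA -mulnA leq_mul2l few_bad orbT.
rewrite (eq_bigr (fun s : {perm V} => \sum_(p in E) (na (f0 (s p.1)) (f0 (s p.2)) : nat))); last first.
  move=> s _; rewrite -sum1_card big_mkcond [RHS]big_mkcond; apply: eq_bigr => p _.
  by rewrite !inE; case: (h _ _); case: (na _ _).
rewrite exchange_big big_distrl; apply: leq_sum => p; rewrite inE => hp.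
apply: leq_trans (pairP _ _ hp); rewrite leq_mul2r -sum1_card big_mkcond [leqRHS]big_mkcond.
by apply/orP; right; apply: leq_sum => s _; rewrite inE; case: (na _ _).
Qed.

(** The badly embedded edges, those in P, receive distinct unused indices g p
    adjacent to both ends. There are enough of them because an end excludes at
    most c indices and the embedding uses |V|. *)
Lemma repairable_embedding : exists (f : V -> I) (P : {set V * V}) (g : V * V -> I),
  [/\ injective f, forall v, f v \in J,
      forall u v, h u v -> (u, v) \notin P -> ~~ na (f u) (f v),
      {in P &, injective g} &
      {in P, forall p, [/\ g p \in J, forall w, g p != f w,
                         ~~ na (f p.1) (g p) & ~~ na (f p.2) (g p)]}].
Proof.
have [f [inj_f fJ few]] := few_bad_embedding.
set P := [set p | _] in few.
pose bad i := [set j in J | (j != i) && na i j].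
pose F (p : V * V) := J :\: ((f @: setT) :|: (bad (f p.1) :|: bad (f p.2))).
have /card_gt0P[i0 _] : 0 < #|J| by lia.
have [p pP|g inj_g gF] := @greedy_sdr _ _ i0 P F.
  apply: leq_trans few _; rewrite cardsD.
  have : #|J :&: ((f @: setT) :|: (bad (f p.1) :|: bad (f p.2)))| <= #|V| + 2 * c.
    apply: leq_trans (subset_leq_card (subsetIr _ _)) _.
    apply: leq_trans (leq_card_setU _ _) _.
    rewrite (card_imset _ inj_f) cardsT leq_add2l.
    apply: leq_trans (leq_card_setU _ _) _.
    by rewrite mul2n -addnn leq_add // na_deg.
  lia.
exists f, P, g; split=> //; first by move=> u v huv; rewrite inE /= huv.
move=> p pP; have := gF p pP; rewrite in_setD in_setU negb_or => /andP[/andP[nf nb] gJ].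
have gf w : g p != f w by apply: contraNneq nf => ->; rewrite imset_f.
move: nb; rewrite !inE gJ !gf /= negb_or => /andP[? ?]; split=> //.
Qed.
End RepairableEmbedding.

Definition touch (G : sgraph) (A B : {set G}) := [exists x in A, exists y in B, adj x y].

Lemma touchP (G : sgraph) (A B : {set G}) :
  reflect (exists x y, [/\ x \in A, y \in B & adj x y]) (touch A B).
Proof.
apply: (iffP exists_inP) => [[x xA /exists_inP[y yB xy]]|[x [y [xA yB xy]]]].
  by exists x, y.
by exists x => //; apply/exists_inP; exists y.
Qed.

Lemma touch_sym (G : sgraph) : symmetric (@touch G).
Proof.
by move=> A B; apply/touchP/touchP => -[x [y [xA yB xy]]]; exists y, x; rewrite adj_sym.
Qed.

Lemma touchS (G : sgraph) (A B A' B' : {set G}) :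
  A \subset A' -> B \subset B' -> touch A B -> touch A' B'.
Proof.
move=> /subsetP sA /subsetP sB /touchP[x [y [xA yB xy]]].
by apply/touchP; exists x, y; rewrite sA ?sB.
Qed.

Lemma branch_minor (H G : sgraph) (br : H -> {set G}) :
  (forall u, br u != set0) -> (forall u, connected_set (br u)) ->
  (forall u v, u != v -> [disjoint br u & br v]) ->
  (forall u v, adj u v -> touch (br u) (br v)) -> minor H G.
Proof.
move=> ne cn dis tch.
pose phi x := [pick u | x \in br u].
have phiP x u : (phi x == Some u) = (x \in br u).
  rewrite /phi; case: pickP => [v xv|none]; last by rewrite none.
  apply/eqP/idP => [[<-] //|xu]; congr Some; apply/eqP; apply: contraLR xu => nvu.
  by rewrite (disjointFr (dis _ _ nvu)).
apply: (@model_minor _ _ phi); split=> [u|u|u v /tch/touchP[x [y [xu yv xy]]]].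
- by have [x xu] := set0Pn _ (ne u); exists x; apply/eqP; rewrite phiP.
- suff -> : [set x | phi x == Some u] = br u by apply: cn.
  by apply/setP=> x; rewrite inE phiP.
- by exists x, y; split=> //; apply/eqP; rewrite phiP.
Qed.


Lemma connected_star (G : sgraph) (K : finType) (Q : pred K) (A : {set G}) (F : K -> {set G}) :
  A != set0 -> connected_set A -> (forall i, Q i -> connected_set (F i)) ->
  (forall i, Q i -> touch A (F i)) -> connected_set (A :|: \bigcup_(i | Q i) F i).
Proof.
move=> /set0Pn[a aA] cA cF tF; apply: (big_ind (fun X => connected_set (A :|: X))).
- by rewrite setU0.
- move=> X Y cX cY; rewrite setUUr.
  by apply: (connected_setU (x := a)); rewrite // inE aA.
- move=> i Qi; have /touchP[x [y [xA yF xy]]] := tF i Qi.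
  exact: (connected_setU_adj xA yF xy cA (cF i Qi)).
Qed.

(** A vertex v of H - S gets the set of its index together with the sets of the
    indices repairing the bad edges that leave v; a vertex of S gets its own set,
    which is adjacent to everything. *)
Lemma assemble_minor (H G : sgraph) (S : {set H}) (N : nat) (J : {set 'I_N})
    (B : 'I_N -> {set G}) (M : H -> {set G}) (c b : nat) :
  {in J, forall i, B i != set0 /\ connected_set (B i)} ->
  {in J &, forall i j, i != j -> [disjoint B i & B j]} ->
  {in J, forall i, #|[set j in J | (j != i) && ~~ touch (B i) (B j)]| <= c} ->
  #|arcs (delete_vertices S)| * c <= b * (#|delete_vertices S| - 2) ->
  2 < #|delete_vertices S| -> #|delete_vertices S| + b + 2 * c <= #|J| ->
  {in S, forall u, M u != set0 /\ connected_set (M u)} ->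
  {in S & J, forall u i, [disjoint M u & B i] /\ touch (M u) (B i)} ->
  {in S &, forall u v, u != v -> [disjoint M u & M v] /\ touch (M u) (M v)} ->
  minor H G.
Proof.
move=> neB disB naB few V_big J_big neM MB MM.
set V := delete_vertices S in few V_big J_big.
have [f [P [g [inj_f fJ nbad inj_g gP]]]] :=
  @repairable_embedding V 'I_N adj (fun i j => ~~ touch (B i) (B j)) J c b
    (@adj_irrefl V) naB few V_big J_big.
pose brV (v : V) := B (f v) :|: \bigcup_(p | (p \in P) && (p.1 == v)) B (g p).
have brV_idx v x : x \in brV v -> exists i, [/\ x \in B i, i \in J &
     i = f v \/ exists p, [/\ p \in P, p.1 = v & i = g p]].
  rewrite inE => /orP[xB|/bigcupP[p /andP[pP /eqP pv] xB]].
    by exists (f v); split=> //; left.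
  by exists (g p); split=> //; [case: (gP p pP) | right; exists p].
have brVJ i v : i = f v \/ (exists p, [/\ p \in P, p.1 = v & i = g p]) -> B i \subset brV v.
  case=> [->|[p [pP pv ->]]]; first exact: subsetUl.
  by apply: subset_trans (subsetUr _ _); apply: (bigcup_max p); rewrite ?pP ?pv ?eqxx.
have disV v w : v != w -> [disjoint brV v & brV w].
  move=> nvw; rewrite -setI_eq0 -subset0; apply/subsetP=> x /setIP[].
  move=> /brV_idx[i [xi iJ ei]] /brV_idx[j [xj jJ ej]].
  have eij : i = j.
    apply/eqP; apply: contraLR xi => nij.
    by rewrite (disjointFl (disB i j iJ jJ nij)).
  subst j; exfalso; move/eqP: nvw; apply.
  case: ei ej => [ei|[p [pP pv ei]]] [ej|[p' [pP' pv' ej]]].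
  - by apply: inj_f; rewrite -ei.
  - by have [_ /(_ v) /eqP[]] := gP p' pP'; rewrite -ej.
  - by have [_ /(_ w) /eqP[]] := gP p pP; rewrite -ei.
  - by rewrite -pv -pv'; congr (_.1); apply: inj_g; rewrite // -ei.
have touchMV u v : u \in S -> touch (M u) (brV v).
  by move=> uS; apply: touchS (MB u (f v) uS (fJ v)).2 => //; apply: brVJ; left.
have disMV u v : u \in S -> [disjoint M u & brV v].
  move=> uS; rewrite -setI_eq0 -subset0; apply/subsetP=> x /setIP[xM].
  by case/brV_idx=> i [xi iJ _]; rewrite (disjointFr (MB u i uS iJ).1) in xi.
have touchVV v w : adj v w -> touch (brV v) (brV w).
  move=> vw; have [vwP|/(nbad v w vw)] := boolP ((v, w) \in P); last first.
    by rewrite negbK; apply: touchS; apply: brVJ; left.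
  have [_ _ _] := gP _ vwP; rewrite negbK touch_sym /=; apply: touchS; apply: brVJ; last by left.
  by right; exists (v, w).
pose br (u : H) := if insub u is Some v then brV v else M u.
have brP (u : H) : (u \in S /\ br u = M u) \/ (exists2 v : V, val v = u & br u = brV v).
  rewrite /br; case: insubP => [v _ E|]; first by right; exists v.
  by rewrite negbK => uS; left.
apply: (@branch_minor _ _ br) => [u|u|u u' nu|u u' uu'].
- case: (brP u) => [[uS ->]|[v _ ->]]; first by have [] := neM u uS.
  by have [/set0Pn[x xB] _] := neB _ (fJ v); apply/set0Pn; exists x; rewrite inE xB.
- case: (brP u) => [[uS ->]|[v _ ->]]; first by have [] := neM u uS.
  have [B0 cB] := neB _ (fJ v); apply: connected_star => // p /andP[pP /eqP pv].
    by have [gJ _ _ _] := gP p pP; have [] := neB _ gJ.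
  by have [_ _ +_] := gP p pP; rewrite negbK pv.
- case: (brP u) => [[uS ->]|[v vu ->]]; case: (brP u') => [[uS' ->]|[v' vu' ->]].
  + by have [] := MM u u' uS uS' nu.
  + exact: disMV.
  + by rewrite disjoint_sym disMV.
  + by apply: disV; apply: contraNneq nu => E; rewrite -vu -vu' E.
- case: (brP u) => [[uS ->]|[v vu ->]]; case: (brP u') => [[uS' ->]|[v' vu' ->]].
  + have nu : u != u' by apply: contraTneq uu' => ->; rewrite adj_irrefl.
    by have [] := MM u u' uS uS' nu.
  + exact: touchMV.
  + by rewrite touch_sym touchMV.
  + by apply: touchVV; rewrite /= /delv_adj vu vu'.
Qed.

(** * Random parts *)

Local Open Scope ring_scope.

(** The form of [perm_exchange] used for probability estimates: mu bounds from
    below the number of points that remain free throughout. *)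
Lemma perm_prob (R : realFieldType) (T : finType) (X Y : {set T})
    (B : {perm T} -> {set T}) (mu : nat) (p : R) :
  [disjoint X & Y] -> (#|X| + #|Y| + mu <= #|T|)%N -> (0 < mu)%N ->
  (forall s, #|B s|%:R <= p * mu%:R) ->
  (forall s y z, y \notin X -> z \notin X -> B (tperm y z * s)%g = B s) ->
  #|all_in B Y|%:R <= (#|T|)`!%:R * p ^+ #|Y|.
Proof.
move=> XY le_m mu_gt0 leB invB.
pose b := (\max_s #|B s|)%N.
have leb s : (#|B s| <= b)%N by apply: (leq_bigmax s).
have mu0 : 0 < mu%:R :> R by rewrite ltr0n.
have p_ge0 : 0 <= p.
  by rewrite -(pmulr_lge0 _ mu0); apply: le_trans (leB 1%g); rewrite ler0n.
have bp : b%:R <= p * mu%:R.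
  rewrite /b; elim/big_ind: _ => [|x y Hx Hy|//]; first by rewrite mulr_ge0 // ltW.
  by rewrite /maxn; case: ifP.
have := perm_exchange leb invB XY.
rewrite -(ler_nat R) !natrM !natrX => le_ex.
have mupos : 0 < (mu%:R : R) ^+ #|Y| by rewrite exprn_gt0.
rewrite -(ler_pM2r mupos) -mulrA -exprMn.
apply: le_trans (_ : _ <= (#|T|)`!%:R * b%:R ^+ #|Y|) _.
  apply: le_trans le_ex; rewrite ler_wpM2l // lerXn2r ?nnegrE // ler_nat; lia.
by rewrite ler_wpM2l // lerXn2r ?nnegrE // mulr_ge0 // ltW.
Qed.

Lemma exists_le_average (R : realFieldType) (F : finType) (f : F -> R) (c : R) :
  (0 < #|F|)%N -> \sum_x f x <= #|F|%:R * c -> exists x, f x <= c.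
Proof.
move=> F_gt0 le_c; apply/existsP; apply: contraLR le_c => /existsPn big.
have [x0 _] := card_gt0P F_gt0.
rewrite -ltNge mulr_natl -sumr_const; apply: ltr_sum; last by move=> x _; rewrite ltNge big.
by apply/hasP; exists x0; rewrite ?mem_index_enum.
Qed.

Lemma disjoint_blocks (T : finType) (N l : nat) : (N * l <= #|T|)%N ->
  exists P : 'I_N -> {set T}, (forall i, #|P i| = l) /\ (forall i j, i != j -> [disjoint P i & P j]).
Proof.
have -> : (N * l = #|{: 'I_N * 'I_l}|)%N by rewrite card_prod !card_ord.
move=> le_T; pose g p := enum_val (widen_ord le_T (enum_rank p)) : T.
have inj_g : injective g.
  by move=> p p' /enum_val_inj /(congr1 val) /= /val_inj /enum_rank_inj.
exists (fun i => [set g (i, j) | j in 'I_l]); split=> [i|i j nij].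
  by rewrite card_imset ?card_ord // => j j' /inj_g [].
rewrite -setI_eq0 -subset0; apply/subsetP=> x /setIP[/imsetP[a _ ->] /imsetP[b _ /inj_g [E _]]].
by rewrite E eqxx in nij.
Qed.

(** T is what remains of the host once the hubs are removed, and C i is the part
    of it that the i-th hub does not dominate. *)
Section RandomParts.
Variables (R : realFieldType) (T : finType) (e : rel T) (N l mu : nat).
Variables (C : 'I_N -> {set T}) (q beta : R).
Hypotheses (e_sym : symmetric e) (N_gt0 : (0 < N)%N) (l_gt0 : (0 < l)%N).
Hypothesis mu_le : (mu + 2 * l <= #|T|)%N.
Hypotheses (le_mu : (#|T| <= 2 * mu)%N) (beta_gt0 : 0 < beta) (q_gt0 : 0 < q).
Hypothesis sparse_non : forall x, #|[set y | ~~ e x y]|%:R <= q * mu%:R.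
Hypothesis small_C : forall i, (40 * l * #|C i| <= mu)%N.
Hypothesis lq_small : (80 * q ^+ l) ^+ l <= beta / 20.

Definition common_non (A : {set T}) := [set y | [forall x in A, ~~ e x y]].

Let mu_gt0 : (0 < mu)%N.
Proof. by move: l_gt0 mu_le le_mu; clear; lia. Qed.

(* The i-th random part is the image of the fixed block P i under a random
   permutation; this makes the parts disjoint. *)
Variable P : 'I_N -> {set T}.
Hypotheses (cardP : forall i, #|P i| = l) (disP : forall i j, i != j -> [disjoint P i & P j]).

Let A (s : {perm T}) i := s @: P i.
Let fact_m : R := (#|T|)`!%:R.
Let big_non s i := 80 * q ^+ l * mu%:R < #|common_non (A s i)|%:R.
Let hits s i := ~~ [disjoint A s i & C i].
Let non_adj s i j := A s j \subset common_non (A s i).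

(** A vertex y is a common non-neighbour of a random part with probability at most
    q ^+ l; the factor 80 comes from the Markov inequality and |T| <= 2 mu. *)
Let prob_big_non i : \sum_s (big_non s i)%:R <= fact_m / 40.
Proof.
have mass : \sum_s (#|common_non (A s i)|%:R : R) <= #|T|%:R * (fact_m * q ^+ l).
  have -> : \sum_s (#|common_non (A s i)|%:R : R) =
            \sum_(y : T) #|all_in (fun _ => [set x | ~~ e x y]) (P i)|%:R.
    rewrite -!natr_sum; congr (_%:R).
    under eq_bigr do rewrite -sum1_card big_mkcond.
    rewrite exchange_big; apply: eq_bigr => y _.
    rewrite -sum1_card [RHS]big_mkcond; apply: eq_bigr => s _; congr (if _ then _ else _).
    rewrite inE [RHS]unfold_in; apply/forall_inP/forall_inP => H x.
      by move=> xP; rewrite inE H // imset_f.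
    by case/imsetP=> z zP ->; have := H z zP; rewrite inE.
  rewrite mulr_natl -sumr_const; apply: ler_sum => y _.
  rewrite -(cardP i); apply: (perm_prob (X := set0) (mu := mu)) => //.
  - by rewrite -setI_eq0 set0I.
  - by rewrite cards0 cardP; lia.
  - move=> _; apply: le_trans (sparse_non y); rewrite ler_nat; apply: subset_leq_card.
    by apply/subsetP=> x; rewrite !inE e_sym.
have ql : 0 < 80 * q ^+ l * mu%:R.
  by rewrite mulr_gt0 ?ltr0n // mulr_gt0 ?exprn_gt0 // ltr0n.
rewrite -(ler_pM2r ql); apply: le_trans (_ : _ <= #|T|%:R * (fact_m * q ^+ l)) _.
  apply: le_trans mass; rewrite big_distrl /=; apply: ler_sum => s _.
  by rewrite /big_non; case: ltP => [/ltW|_]; rewrite ?mul1r ?mul0r.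
have -> : fact_m / 40 * (80 * q ^+ l * mu%:R) = (2 * mu)%:R * (fact_m * q ^+ l).
  by rewrite natrM; field.
by rewrite ler_wpM2r ?ler_nat // mulr_ge0 // exprn_ge0 // ltW.
Qed.

Let prob_hits i : \sum_s (hits s i)%:R <= fact_m / 40.
Proof.
apply: le_trans (_ : _ <= \sum_(x in P i) #|all_in (fun _ => C i) [set x]|%:R) _.
  rewrite -!natr_sum ler_nat.
  under [leqRHS]eq_bigr do rewrite -sum1_card big_mkcond.
  rewrite exchange_big; apply: leq_sum => s _.
  rewrite /hits; case: (boolP [disjoint _ & _]) => //; rewrite -setI_eq0.
  case/set0Pn=> y /setIP[/imsetP[x xP ->] yC].
  rewrite (bigD1 x) //= ifT ?leq_addr // unfold_in; apply/forall_inP=> z.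
  by rewrite inE => /eqP->.
have l0 : l%:R != 0 :> R by rewrite pnatr_eq0 -lt0n.
have -> : fact_m / 40 = \sum_(x in P i) fact_m * (40 * l%:R)^-1.
  by rewrite sumr_const cardP -mulr_natr; field.
apply: ler_sum => x xP.
have -> : (40 * l%:R)^-1 = (40 * l%:R)^-1 ^+ #|[set x]| :> R by rewrite cards1 expr1.
apply: (perm_prob (X := set0) (mu := mu)) => //.
- by rewrite -setI_eq0 set0I.
- by rewrite cards0 cards1; lia.
- move=> _; rewrite mulrC ler_pdivlMr; last by rewrite mulr_gt0 ?ltr0n.
  by have := small_C i; rewrite -(ler_nat R) !natrM; lra.
Qed.

Let prob_non_adj i j : i != j -> \sum_s (~~ big_non s i && non_adj s i j)%:R <= fact_m * (beta / 20).
Proof.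
move=> nij; pose B s := if big_non s i then set0 else common_non (A s i).
apply: le_trans (_ : _ <= #|all_in B (P j)|%:R) _.
  rewrite -natr_sum ler_nat -sum1_card [leqRHS]big_mkcond; apply: leq_sum => s _.
  case: (boolP (~~ big_non s i && non_adj s i j)) => // /andP[nb /subsetP na].
  rewrite ifT // unfold_in; apply/forall_inP=> y yP; rewrite /B (negbTE nb).
  by apply: na; apply: imset_f.
apply: le_trans (_ : _ <= fact_m * (80 * q ^+ l) ^+ #|P j|) _; last first.
  by rewrite cardP ler_wpM2l.
apply: (perm_prob (X := P i) (mu := mu)) => //.
- exact: disP.
- by rewrite !cardP; lia.
- move=> s; rewrite /B; case: (boolP (big_non s i)) => [_|]; last by rewrite -leNgt.
  by rewrite cards0 mulr_ge0 // mulr_ge0 // exprn_ge0 // ltW.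
- move=> s y z yP zP; rewrite /B /big_non.
  suff -> : A (tperm y z * s)%g i = A s i by [].
  apply: eq_in_imset => x xP; rewrite permM tpermD //.
    by apply: contraNneq yP => ->.
  by apply: contraNneq zP => ->.
Qed.

Let bad s i := hits s i || big_non s i.
(** A part that is itself bad is charged as much as a part that misses the
    threshold beta * N, so that one average controls both kinds of failure. *)
Let weight s i : R :=
  if bad s i then beta * N%:R else \sum_(j | j != i) (non_adj s i j)%:R.

Let sum_weight : \sum_s \sum_i weight s i <= fact_m * (beta * N%:R ^+ 2 / 10).
Proof.
rewrite exchange_big /=.
have -> : fact_m * (beta * N%:R ^+ 2 / 10) = \sum_(i < N) fact_m * (beta * N%:R / 10).
  by rewrite sumr_const card_ord -mulr_natr; field.
apply: ler_sum => i _.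
apply: le_trans (_ : _ <= beta * N%:R * (\sum_s (hits s i)%:R + \sum_s (big_non s i)%:R)
   + \sum_(j | j != i) \sum_s (~~ big_non s i && non_adj s i j)%:R) _.
  rewrite mulrDr !mulr_sumr exchange_big -!big_split /=; apply: ler_sum => s _.
  have bN : 0 <= beta * N%:R by rewrite mulr_ge0 // ltW.
  rewrite /weight /bad; case: (hits s i); case: (big_non s i); rewrite /= ?mulr1 ?mulr0 ?add0r //;
    by rewrite -?addrA lerDl ?addr_ge0 ?sumr_ge0.
have part : \sum_(j | j != i) \sum_s (~~ big_non s i && non_adj s i j)%:R <= N%:R * (fact_m * (beta / 20)).
  apply: le_trans (_ : _ <= \sum_(j | j != i) fact_m * (beta / 20)) _.
    by apply: ler_sum => j nji; apply: prob_non_adj; rewrite eq_sym.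
  rewrite sumr_const -[leLHS]mulr_natl ler_wpM2r //; first by rewrite mulr_ge0 // divr_ge0 // ltW.
  by rewrite ler_nat; apply: leq_trans (max_card _) _; rewrite card_ord.
have := lerD (ler_wpM2l _ (lerD (prob_hits i) (prob_big_non i))) part.
move=> /(_ (beta * N%:R)) /(_ ltac:(by rewrite mulr_ge0 // ltW)) /le_trans; apply.
by rewrite le_eqVlt; apply/orP; left; apply/eqP; field.
Qed.

(** The indices outside J are the bad ones and those not adjacent to more than
    beta * N others; the weight of each is at least beta * N. *)
Lemma random_parts : exists (B : 'I_N -> {set T}) (J : {set 'I_N}),
  [/\ forall i j, i != j -> [disjoint B i & B j],
      forall i, i \in J -> [disjoint B i & C i],
      (10 * #|~: J| <= N)%N &
      forall i, i \in J ->
        #|[set j | (j != i) && [forall x in B i, forall y in B j, ~~ e x y]]|%:R <= beta * N%:R].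
Proof.
have [s ws] : exists s, \sum_i weight s i <= beta * N%:R ^+ 2 / 10.
  by apply: exists_le_average; rewrite card_permT ?fact_gt0.
have bN : 0 < beta * N%:R by rewrite mulr_gt0 // ltr0n.
exists (A s), [set i | ~~ bad s i & weight s i <= beta * N%:R]; split.
- move=> i j nij; rewrite -setI_eq0 -subset0; apply/subsetP=> y.
  case/setIP=> /imsetP[a aP ->] /imsetP[b bP /perm_inj E].
  by have := disP nij; rewrite -setI_eq0 => /eqP/setP/(_ a); rewrite !inE aP E bP.
- by move=> i; rewrite inE negb_or negbK => /andP[/andP[]].
- rewrite -(ler_nat R) natrM -(ler_pM2r bN).
  apply: le_trans (_ : _ <= 10 * \sum_i weight s i) _; last by lra.
  rewrite -mulrA ler_pM2l ?ltr0n // -sum1_card natr_sum big_distrl /= [leLHS]big_mkcond.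
  apply: ler_sum => i _; rewrite !inE mul1r.
  have w_ge0 : 0 <= weight s i.
    by rewrite /weight; case: ifP => _; [apply: ltW | apply: sumr_ge0].
  case: (boolP (bad s i)) => /= [b|_]; first by rewrite /weight b.
  by case: (leP (weight s i)) => //= /ltW.
- move=> i; rewrite inE => /andP[nb]; rewrite /weight (negbTE nb).
  apply: le_trans; rewrite -natr_sum ler_nat -sum1_card big_mkcond [leqRHS]big_mkcond.
  apply: leq_sum => j _; rewrite inE; case: (j != i) => //=.
  case: forall_inP => // H; rewrite /non_adj (_ : _ \subset _) //.
  apply/subsetP=> y yA; rewrite inE; apply/forall_inP=> x xA.
  by have /forall_inP := H x xA; apply.
Qed.
End RandomParts.

Local Close Scope ring_scope.

(** * The minor in the host *)

Lemma disjoint_setU (T : finType) (A B C : {set T}) :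
  [disjoint A & C] -> [disjoint B & C] -> [disjoint A :|: B & C].
Proof. by rewrite !disjoints_subset subUset => -> ->. Qed.

Lemma connected_dominated (G : sgraph) (U K A : {set G}) :
  K != set0 -> connected_set K -> A \subset U -> [disjoint A & undominated U K] ->
  connected_set (K :|: A).
Proof.
move=> K0 cK AU dom; have -> : A = \bigcup_(x | x \in A) [set x].
  by apply/setP=> x; apply/idP/bigcupP => [xA|[y yA]]; [exists x; rewrite ?inE | rewrite inE => /eqP->].
apply: connected_star => // x xA; first exact: connected_set1.
have := disjointFr dom xA; rewrite inE (subsetP AU) //= => /negbFE/exists_inP[y yK yx].
by apply/touchP; exists y, x; rewrite inE.
Qed.

(** The numerical requirements of the construction. Here s = |S|, t = |H - S|, and
    a is twice the number of edges of H - S; k and kap measure the host and the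
    room for hubs in it; l is the size of the N random parts; r and r' are the
    numbers of rounds for the hubs of the indices and for those of S; an index is
    non-adjacent to at most beta * N others, rounded down to c; and b bounds the
    number of edges to repair. *)
Record host_parameters (R : realFieldType) (s t a k kap l N r r' c b : nat) (beta : R) :
    Prop := HostParameters {
  _ : 60 * l + 20 <= k;
  _ : 20 * kap <= k;
  _ : s * (6 * r' + 1) + N * (6 * r + 1) <= kap;
  _ : 3 ^ r' * (2 * k + 1) < 5 ^ r';
  _ : 240 * l * 3 ^ r <= 5 ^ r;
  _ : 0 < l;
  _ : 0 < N;
  _ : N * l + 2 * kap <= k;
  _ : (0 < beta)%R;
  _ : ((80 * (11 / 20) ^+ l) ^+ l <= beta / 20)%R;
  _ : forall n : nat, (n%:R <= beta * N%:R)%R -> n <= c;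
  _ : a * c <= b * (t - 2);
  _ : 2 < t;
  _ : 10 * (t + b + 2 * c) <= 9 * N }.

Section Host.
Variables (R : realFieldType) (G H : sgraph) (S : {set H}) (U : {set G}).
Variables (k kap l N r r' c b : nat) (beta : R).
Hypothesis params : host_parameters #|S| #|delete_vertices S| #|arcs (delete_vertices S)|
  k kap l N r r' c b beta.
Hypotheses (U_ne : U != set0) (sU : #|U| <= 2 * k + 1).
Hypothesis degU : {in U, forall x, k - kap <= #|[set y in U | adj x y]|}.
Hypothesis linkU : linked U kap.

Lemma host_minor : minor H G.
Proof.
case: params => k_ge kap_le hub_room r'_big r_big l_gt0 N_gt0 Nl_le beta_gt0 lq_small c_ge few V_big N_big.
have k_ge5 : 5 <= k by lia.
have kU : k - kap <= #|U|.
  have [x xU] := set0Pn _ U_ne; apply: leq_trans (degU xU) _.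
  by apply/subset_leq_card/subsetP=> y; rewrite inE => /andP[].
have sX0 : #|@set0 G| + #|S| * (6 * r' + 1) <= kap by rewrite cards0; lia.
have [M0 [M0P disM0]] := hubs k_ge5 kap_le U_ne sU degU linkU sX0.
pose X := \bigcup_(i < #|S|) M0 i.
have sX : #|X| + N * (6 * r + 1) <= kap.
  apply: leq_trans hub_room; rewrite leq_add2r; apply: card_bigcup_ord.
  by move=> i iS; case: (M0P i iS).
have [K [KP disK]] := hubs k_ge5 kap_le U_ne sU degU linkU sX.
pose W := X :|: \bigcup_(i < N) K i.
have sW : #|W| <= kap.
  apply: leq_trans sX; apply: leq_trans (leq_card_setU _ _) _; rewrite leq_add2l.
  by apply: card_bigcup_ord => i iN; case: (KP i iN).
pose T := {x : G | x \in U :\: W}.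
pose e : rel T := fun x y => adj (val x) (val y).
have cardT : #|{: T}| = #|U :\: W| by rewrite card_sig; apply: eq_card.
have cardUW : #|U| - kap <= #|U :\: W|.
  by rewrite cardsD; apply: leq_sub2l; apply: leq_trans sW; apply/subset_leq_card/subsetIr.
pose mu := #|{: T}| - 2 * l.
pose C (i : 'I_N) := [set x : T | val x \in undominated U (K i)].
have e_sym : symmetric e by move=> x y; apply: adj_sym.
have Nl : N * l <= #|{: T}| by rewrite cardT; lia.
have mu_le : mu + 2 * l <= #|{: T}| by rewrite /mu cardT; lia.
have le_mu : #|{: T}| <= 2 * mu by rewrite /mu cardT; lia.
have sparse x : (#|[set y | ~~ e x y]|%:R <= (11 / 20 : R) * mu%:R)%R.
  (* x loses at most |W| neighbours and the host loses exactly |W| vertices, so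
     x has at most |U| - (k - kap) non-neighbours left. *)
  suff : 20 * #|[set y | ~~ e x y]| <= 11 * mu by rewrite -(ler_nat R) !natrM; lra.
  have xU : val x \in U by have := valP x; rewrite inE => /andP[].
  have deg_x := degU xU.
  have split_nbrs : #|[set y in U | adj (val x) y]| <= #|[set y | e x y]| + #|W|.
    apply: leq_trans (_ : #|(val @: [set y | e x y]) :|: W| <= _).
      apply: subset_leq_card; apply/subsetP=> y; rewrite [y \in _]inE => /andP[yU xy].
      rewrite inE orbC; case: (boolP (y \in W)) => //= yW.
      have yV : y \in U :\: W by rewrite inE yW.
      by apply/imsetP; exists (Sub y yV : T); rewrite ?inE.
    by apply: leq_trans (leq_card_setU _ _) _; rewrite card_imset //; apply: val_inj.
  have split_T : #|[set y | e x y]| + #|[set y | ~~ e x y]| = #|{: T}|.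
    rewrite -(cardsC [set y | e x y]); congr (_ + _).
    by apply: eq_card => y; rewrite !inE.
  have split_U : #|U :\: W| + #|U :&: W| = #|U| by rewrite addnC cardsID.
  have WU : U :&: W = W.
    apply/setIidPr; rewrite subUset; apply/andP; split; apply/bigcupsP=> i _.
      by case: (M0P i (ltn_ord i)) => /subset_trans-> //; apply: subsetDl.
    by case: (KP i (ltn_ord i)) => /subset_trans-> //; apply: subsetDl.
  rewrite WU in split_U.
  rewrite /mu cardT; rewrite cardT in split_T; move: deg_x split_nbrs split_T split_U sW sU kap_le k_ge.
  move: #|[set y in U | _]| #|[set y | e x y]| #|[set y | ~~ e x y]| #|U :\: W| #|W| #|U|.
  by clear; move=> *; lia.
have smallC i : 40 * l * #|C i| <= mu.
  have [_ _ _ _ domK] := KP i (ltn_ord i).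
  have leC : #|C i| <= #|undominated U (K i)|.
    rewrite -(card_imset _ val_inj); apply: subset_leq_card.
    by apply/subsetP=> y /imsetP[x]; rewrite inE => xK ->.
  have mu6 : 2 * k + 1 <= 6 * mu by rewrite /mu cardT; lia.
  have p5 : 0 < 5 ^ r by rewrite expn_gt0.
  (* Multiplied by 6 * 5 ^ r, the claim follows from the hypothesis on r. *)
  have h1 := leq_mul (leqnn (40 * l)) (leq_trans (leq_mul (leqnn (5 ^ r)) leC) domK).
  have h2 := leq_mul r_big (leqnn (2 * k + 1)).
  have h3 := leq_mul (leqnn (5 ^ r)) mu6.
  have h4 := leq_mul (leqnn (40 * l * 3 ^ r)) sU.
  rewrite -(leq_pmul2l p5) -(leq_pmul2l (isT : 0 < 6)).
  move: h1 h2 h3 h4; move: #|C i| #|U| (5 ^ r) (3 ^ r) => x u f g; clear; lia.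
have [P [cardP disP]] := disjoint_blocks Nl.
have q_gt0 : (0 < 11 / 20 :> R)%R by lra.
have [A [J [disA domA cardJ degJ]]] :=
  random_parts e_sym N_gt0 l_gt0 mu_le le_mu beta_gt0 q_gt0 sparse smallC lq_small cardP disP.
pose A' i := val @: A i.
have A'UW i : A' i \subset U :\: W by apply/subsetP=> y /imsetP[x _ ->]; apply: valP.
pose B (i : 'I_N) := K i :|: A' i.
pose M u := M0 (index u (enum S)).
have idx u : u \in S -> index u (enum S) < #|S| by move=> uS; rewrite cardE index_mem mem_enum.
have MX u : u \in S -> M u \subset X by move=> uS; apply: (bigcup_max (Ordinal (idx u uS))).
have KW (i : 'I_N) : K i \subset W.
  by apply: subset_trans (subsetUr _ _); apply: (bigcup_max i).
have XW : X \subset W by apply: subsetUl.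
have KU (i : 'I_N) : K i \subset U :\: X by case: (KP i (ltn_ord i)).
have KU' (i : 'I_N) : K i \subset U by apply: subset_trans (KU i) (subsetDl _ _).
have disWA i (Z : {set G}) : Z \subset W -> [disjoint Z & A' i].
  move=> ZW; rewrite disjoint_sym disjoints_subset; apply: subset_trans (A'UW i) _.
  by rewrite setDE; apply: subset_trans (subsetIr _ _) _; rewrite setCS.
have domM u x : u \in S -> x \in U -> exists2 y, y \in M u & adj y x.
  move=> uS xU; have [_ _ _ _ dom] := M0P _ (idx u uS).
  have : undominated U (M u) == set0.
    rewrite -cards_eq0 -leqn0 leqNgt; apply/negP=> pos.
    have h1 := leq_mul (leqnn (5 ^ r')) pos; have h2 := leq_mul (leqnn (3 ^ r')) sU.
    by move: (leq_trans h1 (leq_trans dom h2)); rewrite muln1 leqNgt r'_big.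
  move/eqP/setP/(_ x); rewrite !inE xU /= => /negbFE/exists_inP[y yM yx].
  by exists y.
apply: (@assemble_minor H G S N J B M c b) => //.
- move=> i iJ; have [_ K0 cK _ _] := KP i (ltn_ord i); split.
    by have [x xK] := set0Pn _ K0; apply/set0Pn; exists x; rewrite inE xK.
  apply: (connected_dominated (U := U)) => //.
    by apply: subset_trans (A'UW i) (subsetDl _ _).
  rewrite -setI_eq0 -subset0; apply/subsetP=> y /setIP[/imsetP[x xA ->] yK].
  by have := disjointFr (domA i iJ) xA; rewrite inE yK.
- move=> i j iJ jJ nij.
  apply: disjoint_setU; rewrite disjoint_sym; apply: disjoint_setU.
  + by apply: disK; rewrite // eq_sym.
  + by rewrite disjoint_sym disWA.
  + exact: disWA.
  + rewrite -setI_eq0 -subset0; apply/subsetP=> x /setIP[/imsetP[y yA ->] /imsetP[z zA /val_inj E]].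
    by have := disjointFr (disA i j nij) zA; rewrite -E yA.
- move=> i iJ; apply: c_ge; apply: le_trans (degJ i iJ); rewrite ler_nat.
  apply: subset_leq_card; apply/subsetP=> j; rewrite !inE => /and3P[_ -> nt] /=.
  apply/forall_inP=> x xA; apply/forall_inP=> y yA; apply: contra nt => xy.
  by apply/touchP; exists (val x), (val y); rewrite !inE !imset_f ?orbT.
- apply: leq_trans (_ : N - #|~: J| <= #|J|); last first.
    by have := cardsC J; rewrite card_ord; lia.
  lia.
- by move=> u uS; have [_ M0' cM _ _] := M0P _ (idx u uS).
- move=> u i uS iJ; split.
    rewrite disjoint_sym; apply: disjoint_setU; last first.
      by rewrite disjoint_sym disWA // (subset_trans (MX u uS)).
    rewrite disjoints_subset; apply: subset_trans (KU i) _.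
    by rewrite setDE; apply: subset_trans (subsetIr _ _) _; rewrite setCS MX.
  have [_ K0 _ _ _] := KP i (ltn_ord i); have [x xK] := set0Pn _ K0.
  have [y yM yx] := domM u x uS (subsetP (KU' i) _ xK).
  by apply/touchP; exists y, x; rewrite inE xK.
- move=> u v uS vS nuv; split.
    apply: disM0; rewrite ?idx //; apply: contraNneq nuv => /(congr1 (nth u (enum S))).
    by rewrite !nth_index ?mem_enum // => ->.
  have [MU K0 _ _ _] := M0P _ (idx v vS); have [x xM] := set0Pn _ K0.
  have [y yM yx] := domM u x uS (subsetP (subset_trans MU (subsetDl _ _)) _ xM).
  by apply/touchP; exists y, x.
Qed.
End Host.
(** * Growth estimates *)

From mathcomp Require Import all_classical all_reals all_analysis.

Local Open Scope ring_scope.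

Lemma bernoulli_nat (a n : nat) : ((n + a) * a ^ n <= a * a.+1 ^ n)%N.
Proof.
elim: n => [|n IHn]; first by rewrite !expn0 muln1.
rewrite !expnS; have := leq_mul (leqnn a.+1) IHn.
have := leq0n (n * a ^ n); move: (a ^ n)%N (a.+1 ^ n)%N => x y; clear; nia.
Qed.

Lemma three_five_growth (C n : nat) : (12 * C <= n)%N -> (C * n.+1 * 3 ^ n <= 5 ^ n)%N.
Proof.
move=> le_n; have h3 := bernoulli_nat 3 n; have h4 := bernoulli_nat 4 n.
have h := leq_mul (leqnn 3) h4; have h' := leq_mul (leqnn (n + 4)) h3.
have h2 : (12 * (C * n.+1) <= (n + 4) * (n + 3))%N.
  by rewrite mulnA; apply: leq_mul; lia.
have h5 := leq_mul h2 (leqnn (3 ^ n)).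
move: h h' h5; move: (3 ^ n)%N (4 ^ n)%N (5 ^ n)%N => x y z; clear; lia.
Qed.

Lemma hub_growth (a b : nat) : (0 < b)%N -> exists l0 : nat, forall l, (l0 <= l)%N ->
  (a * l * 3 ^ (l %/ b) <= 5 ^ (l %/ b))%N.
Proof.
move=> b_gt0; exists (12 * (a * b) * b)%N => l le_l.
apply: leq_trans (three_five_growth (C := a * b) _); last by rewrite leq_divRL.
by rewrite leq_mul2r -mulnA leq_mul2l [(b * _)%N]mulnC (ltnW (ltn_ceil _ _)) ?orbT.
Qed.

(** As 7/4 * 11/20 = 77/80 < 1, the factor (77/80)^(l^2) eventually beats all
    the other factors, which are only exponential in l. *)
Lemma part_growth (R : realType) : exists l0 : nat, forall l (d : R), (l0 <= l)%N -> 0 < d ->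
  d <= (7 / 4) ^+ (l.+1 ^ 2) -> (80 * (11 / 20) ^+ l) ^+ l <= (50 * d)^-1 / 20.
Proof.
exists (Num.truncn (130 * 100 : R)).+1 => l d le_l d_gt0 le_d.
have d0 : d != 0 by rewrite gt_eqF.
have le_lR : 130 * 100 <= l%:R :> R.
  by apply: le_trans (ltW (truncnS_gt _)) _; rewrite ler_nat.
suff le1 : 20 * 50 * (7 / 4 : R) ^+ (l.+1 ^ 2) * (80 * (11 / 20) ^+ l) ^+ l <= 1.
  have -> : (50 * d)^-1 / 20 = (20 * 50 * d)^-1 by field.
  have d1000 : 0 < 20 * 50 * d by lra.
  rewrite -[leRHS]mul1r ler_pdivlMr //; apply: le_trans le1; rewrite mulrC.
  apply: ler_wpM2r; last by lra.
  by rewrite exprn_ge0 // mulr_ge0 // exprn_ge0 //; lra.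
have -> : (l.+1 ^ 2 = l * l + (l + l) + 1)%N by lia.
have -> : 20 * 50 * (7 / 4 : R) ^+ (l * l + (l + l) + 1) * (80 * (11 / 20) ^+ l) ^+ l =
    35 * 50 * (245 * (77 / 80) ^+ l) ^+ l.
  have -> : 77 / 80 = 7 / 4 * (11 / 20) :> R by field.
  have -> : 245 = (7 / 4) * (7 / 4) * 80 :> R by field.
  have -> : 35 * 50 = 20 * 50 * (7 / 4) :> R by field.
  move: (7 / 4 : R) (11 / 20 : R) (80 : R) => x q e.
  by rewrite !exprD expr1 !exprMn exprM; ring.
have e27 : (77 / 80 : R) ^+ l * (l%:R + 26) <= 26.
  have := bernoulli_nat 26 l; rewrite -(ler_nat R) !natrM !natrX natrD => bern.
  have p27 : 0 < (27%:R : R) ^+ l by rewrite exprn_gt0.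
  apply: le_trans (_ : _ <= (26 / 27) ^+ l * (l%:R + 26)) _.
    by rewrite ler_wpM2r ?addr_ge0 // lerXn2r ?nnegrE; lra.
  by rewrite -(ler_pM2r p27) expr_div_n mulrAC mulfVK ?gt_eqF // mulrC.
have half : 245 * (77 / 80 : R) ^+ l <= 1 / 2.
  have x_ge0 : 0 <= (77 / 80 : R) ^+ l by rewrite exprn_ge0; lra.
  move: e27; rewrite mulrDr; have := ler_wpM2l x_ge0 le_lR; lra.
have half_l : (245 * (77 / 80 : R) ^+ l) ^+ l <= (1 / 2) ^+ l.
  by rewrite lerXn2r ?nnegrE ?mulr_ge0 ?exprn_ge0; lra.
have := bernoulli_nat 1 l; rewrite exp1n muln1 mul1n -(ler_nat R) natrX natrD => bern2.
have : (1 / 2 : R) ^+ l * 2 ^+ l = 1 by rewrite -exprMn mul1r mulVf ?expr1n // pnatr_eq0.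
have : 0 <= (1 / 2 : R) ^+ l by rewrite exprn_ge0; lra.
move: half_l bern2; move: (_ ^+ l) ((1 / 2) ^+ l) (2 ^+ l) => x y z xy lz y_ge0 yz.
have := ler_wpM2l y_ge0 (le_trans _ lz : 35 * 50 <= z).
by move=> /(_ ltac:(lra)); lra.
Qed.

(** * Choice of the parameters *)

Lemma expR_le_inv (R : realType) (x : R) : 0 <= x -> x < 1 -> expR x * (1 - x) <= 1.
Proof.
move=> x_ge0 x_lt1; have := expR_ge1Dx (- x); rewrite expRN => le_inv.
have e_gt0 := expR_gt0 x.
by rewrite mulrC -ler_pdivlMr // mul1r.
Qed.

Lemma expR1_le4 (R : realType) : expR 1 <= 4 :> R.
Proof.
have -> : 1 = 2%:R * (1 / 2) :> R by field.
rewrite expRM_natl; have := @expR_le_inv R (1 / 2) ltac:(lra) ltac:(lra).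
have := expR_gt0 (1 / 2 : R); move: (expR _) => x *; rewrite expr2; nra.
Qed.

(** Since l + 1 > 13/9 L, this bounds d = exp (L^2) by (7/4)^((l + 1)^2). *)
Lemma expR81_le (R : realType) : expR (81 / 169) <= 7 / 4 :> R.
Proof.
have -> : 81 / 169 = 2%:R * (81 / 338) :> R by field.
rewrite expRM_natl; have := @expR_le_inv R (81 / 338) ltac:(lra) ltac:(lra).
have := expR_gt0 (81 / 338 : R); move: (expR _) => x x_gt0 le1; rewrite expr2.
have : x <= 33 / 25 by lra.
by nra.
Qed.

Lemma power_four_large (R : realType) (t : R) : 0 < t ->
  t ^+ 2 <= 4 ^+ (Num.truncn (2 * ln t)).+1.
Proof.
move=> t_gt0; have {1}-> : t = expR (ln t) by rewrite lnK.
rewrite -expRM_natl; apply: le_trans (_ : _ <= expR ((Num.truncn (2 * ln t)).+1%:R * 1)) _.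
  by rewrite mulr1 ler_expR; apply/ltW/truncnS_gt.
by rewrite expRM_natl lerXn2r ?nnegrE ?expR_ge0 // expR1_le4.
Qed.

(** 3 u rounds leave a proportion (3/5)^(3u) <= 4^(-u) undominated. *)
Lemma dominating_rounds (u k : nat) : (2 * k + 1 < 4 ^ u)%N ->
  (3 ^ (3 * u) * (2 * k + 1) < 5 ^ (3 * u))%N.
Proof.
move=> lt4; rewrite !expnM; apply: (@leq_trans ((3 ^ 3) ^ u * 4 ^ u)).
  by rewrite ltn_mul2l expn_gt0.
by rewrite -expnMn; case: (u) => // v; rewrite leq_exp2r.
Qed.

Lemma divn_bounds (R : realFieldType) (n q : nat) : (0 < q)%N ->
  (n%:R / q%:R - 1 <= (n %/ q)%:R :> R) * ((n %/ q)%:R <= n%:R / q%:R :> R).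
Proof.
move=> q_gt0; have q0 : 0 < q%:R :> R by rewrite ltr0n.
split; last by rewrite ler_pdivlMr // -natrM ler_nat leq_divM.
by rewrite lerBlDr natr1 ler_pdivrMr // -natrM ler_nat ltnW // ltn_ceil.
Qed.

Lemma tenth_power_le (R : realFieldType) : 10 ^- 5 <= 1 / 100 :> R.
Proof.
rewrite div1r lef_pV2 ?posrE ?exprn_gt0 ?ltr0n //.
have -> : 100 = 10 ^+ 2 :> R by rewrite expr2; ring.
by rewrite ler_weXn2l //; lra.
Qed.

Lemma few_bad_real (R : realFieldType) (d t c b n : R) :
  0 < d -> 100 <= t -> c <= (50 * d)^-1 * n -> n <= 5 * t / 4 -> t / 20 - 1 <= b ->
  d * t * c <= b * (t - 2).
Proof.
move=> d_gt0 t_big c_le n_le b_ge.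
have h : 0 < (50 * d)^-1 by rewrite invr_gt0; lra.
have dt : 0 <= d * t by apply: mulr_ge0; lra.
apply: le_trans (_ : d * t * ((50 * d)^-1 * (5 * t / 4)) <= _).
  by rewrite ler_wpM2l //; apply: le_trans c_le _; rewrite ler_wpM2l // ltW.
have -> : d * t * ((50 * d)^-1 * (5 * t / 4)) = t * t / 40 by field; rewrite gt_eqF.
by apply: le_trans (_ : (t / 20 - 1) * (t - 2) <= _); nra.
Qed.

Lemma exponent_le (R : realFieldType) (L : R) (l : nat) : 0 <= L ->
  13 / 9 * L - 1 <= l%:R -> L ^+ 2 <= (l.+1 ^ 2)%:R * (81 / 169).
Proof.
move=> L_ge0 l_gt; rewrite natrX -natr1.
have : L <= 9 / 13 * (l%:R + 1) by lra.
move: (l%:R + 1) => x Lx; rewrite !expr2.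
have -> : x * x * (81 / 169) = (9 / 13 * x) * (9 / 13 * x) by field.
by apply: ler_pM.
Qed.

Lemma small_c_real (R : realFieldType) (d c n : R) : 1 <= d -> 0 <= n ->
  c <= (50 * d)^-1 * n -> c <= n / 50.
Proof.
move=> d1 n0 c_le; apply: le_trans c_le _; rewrite mulrC ler_wpM2l //.
by rewrite lef_pV2 ?posrE; lra.
Qed.

(** With p = t L, the host has at least 39/40 k >= 1.89 p vertices. The random
    parts occupy at most 65/36 p <= 1.81 p of them; the hubs of the indices and
    those of S occupy at most 0.02 p and 0.6 t, since the hub of an index has
    about 6 l / 1000 vertices and that of a vertex of S about 36 ln t. *)
Lemma admissible_parameters (R : realType) : exists d0 : R,
  forall (s t a : nat) (d : R), d0 <= d -> d <= t%:R -> a%:R = d * t%:R ->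
    s%:R <= 10 ^- 5 * (t%:R / ln t%:R) :> R ->
  exists (k kap l N r r' c b : nat) (beta : R),
    [/\ (0 < k)%N, (2 * k)%:R <= (3895 / 1000) * t%:R * Num.sqrt (ln d) &
        host_parameters s t a k kap l N r r' c b beta].
Proof.
have [l1 hub_ok] := @hub_growth 240 1000 isT.
have [l2 part_ok] := part_growth R.
pose L0 : R := 10 * 100 + l1%:R + l2%:R.
have L0_big : 10 * 100 <= L0.
  by rewrite /L0; have := ler0n R l1; have := ler0n R l2; lra.
have L0_l1 : l1%:R <= L0 by rewrite /L0; have := ler0n R l1; have := ler0n R l2; lra.
have L0_l2 : l2%:R <= L0 by rewrite /L0; have := ler0n R l1; have := ler0n R l2; lra.
move: L0 L0_big L0_l1 L0_l2 => L0 L0_big L0_l1 L0_l2.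
exists (expR (L0 ^+ 2)) => s t a d d_ge d_le_t a_eq s_le.
have d_gt0 : 0 < d := lt_le_trans (expR_gt0 _) d_ge.
have lnd_ge : L0 ^+ 2 <= ln d by rewrite -(expRK (L0 ^+ 2)) ler_ln ?posrE ?expR_gt0.
have lnd_ge0 : 0 <= ln d by apply: le_trans lnd_ge; apply: sqr_ge0.
set L : R := Num.sqrt (ln d).
have L_ge0 : 0 <= L by apply: sqrtr_ge0.
have L2 : L ^+ 2 = ln d by rewrite sqr_sqrtr.
have L_ge : L0 <= L.
  by rewrite -(@ler_pXn2r _ 2) ?nnegrE ?L2 //; lra.
have dL : d = expR (L ^+ 2) by rewrite L2 lnK.
have d_L2 : 1 + L ^+ 2 <= d by rewrite dL expR_ge1Dx.
have lnt_ge : L ^+ 2 <= ln t%:R.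
  by rewrite L2 ler_ln ?posrE //; apply: lt_le_trans d_le_t.
clearbody L; clear d_ge lnd_ge lnd_ge0 L2.
have {}L0_l1 := le_trans L0_l1 L_ge; have {}L0_l2 := le_trans L0_l2 L_ge.
have L_big := le_trans L0_big L_ge.
clear L_ge L0_big L0.
have L2_big : 10 * 100 * L <= L ^+ 2 by rewrite expr2 ler_wpM2r.
set tR : R := t%:R in d_le_t a_eq s_le lnt_ge *.
have t_big : 10 * 100 * L <= tR by lra.
pose p := tR * L.
have p_big : 10 * 100 * tR <= p by rewrite /p mulrC ler_wpM2l //; lra.
have p_small : 10 * 100 * p <= tR ^+ 2.
  by rewrite expr2 /p mulrCA ler_wpM2l //; lra.
(* Rounded so that the linear arithmetic deals with small numerals. *)
pose C : R := 3895 / 1000.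
have C_lo : 389 / 100 <= C by rewrite /C ler_pdivlMr ?ltr0n //; lra.
have C_hi : C <= 39 / 10 by rewrite /C ler_pdivrMr ?ltr0n //; lra.
have -> : 3895 / 1000 * tR * L = C * p by rewrite /C /p mulrA.
clearbody C.
have p_ge0 : 0 <= p by lra.
have Cp_lo : 389 / 100 * p <= C * p by rewrite ler_wpM2r.
have Cp_hi : C * p <= 39 / 10 * p by rewrite ler_wpM2r.
move: (C * p) Cp_lo Cp_hi => D D_lo D_hi.
have lnt_ge1 : 1 <= ln tR.
  by apply: le_trans lnt_ge; apply: le_trans L2_big; lra.
have tR_gt0 : 0 < tR by lra.
pose k := Num.truncn (D / 2); pose l := Num.truncn (13 / 9 * L).
have k_le : k%:R <= D / 2 by rewrite truncn_le; lra.
have k_gt : D / 2 - 1 <= k%:R by rewrite lerBlDr natr1 ltW // truncnS_gt.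
have l_le : l%:R <= 13 / 9 * L by rewrite truncn_le; lra.
have l_gt : 13 / 9 * L - 1 <= l%:R by rewrite lerBlDr natr1 ltW // truncnS_gt.
have kD : (2 * k)%:R <= D by rewrite natrM; move: k_le; clear; lra.
pose u := Num.truncn (2 * ln tR).
have u_le : u%:R <= 2 * ln tR by rewrite truncn_le; lra.
pose kap := (k %/ 40)%N; pose N := (5 * t %/ 4)%N; pose b := (t %/ 20)%N.
pose r := (l %/ 1000)%N.
pose beta : R := (50 * d)^-1; pose c := Num.truncn (beta * N%:R).
have beta_gt0 : 0 < beta by rewrite invr_gt0 mulr_gt0.
have c_le : c%:R <= beta * N%:R by rewrite truncn_le mulr_ge0 // ltW.
have [N_gt N_le] := @divn_bounds R (5 * t) 4 isT.
rewrite natrM -/N -/tR in N_gt N_le.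
have [kap_gt kap_le] := @divn_bounds R k 40 isT; rewrite -/kap in kap_gt kap_le.
have [b_gt b_le] := @divn_bounds R t 20 isT; rewrite -/b -/tR in b_gt b_le.
have [_ r_le] := @divn_bounds R l 1000 isT; rewrite -/r in r_le.
have {}r_le : r%:R <= 2 / 1000 * L.
  apply: le_trans r_le _; rewrite ler_pdivrMr ?ltr0n //.
  by move: l_le L_big; clear; move: (l%:R) => x *; rewrite mulrAC divfK ?pnatr_eq0 //; lra.
have l_gt' : L + 1 <= l%:R by move: l_gt L_big; clear; lra.
have k_ge : 194 / 100 * p <= k%:R.
  by move: k_gt D_lo p_big t_big L_big; clear; lra.
clear k_le k_gt.
have l1_le : (l1 <= l)%N.
  by rewrite -(ler_nat R); move: L0_l1 l_gt'; clear; lra.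
have l2_le : (l2 <= l)%N.
  by rewrite -(ler_nat R); move: L0_l2 l_gt'; clear; lra.
have Nl_le : N%:R * l%:R <= 65 / 36 * p.
  have -> : 65 / 36 * p = (5 * tR / 4) * (13 / 9 * L) by rewrite /p; field.
  by apply: ler_pM.
have Nr_le : N%:R * r%:R <= 3 / 1000 * p.
  apply: le_trans (_ : (5 * tR / 4) * (2 / 1000 * L) <= _); first by apply: ler_pM.
  by rewrite /p in p_ge0 *; move: p_ge0; clear; lra.
have s_small : s%:R * ln tR <= 1 / 100 * tR.
  have lnt_gt0 : 0 < ln tR by apply: lt_le_trans lnt_ge1.
  apply: le_trans (ler_wpM2r (ltW lnt_gt0) s_le) _.
  have -> : 10 ^- 5 * (tR / ln tR) * ln tR = 10 ^- 5 * tR.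
    by rewrite -[LHS]mulrA; congr (_ * _); rewrite divfK // gt_eqF.
  by rewrite ler_wpM2r ?tenth_power_le // ltW.
have hub_room : (s * (6 * (3 * u.+1) + 1) + N * (6 * r + 1) <= kap)%N.
  have s1 : s%:R <= s%:R * ln tR by rewrite ler_peMr.
  have su : s%:R * u%:R <= 2 * (s%:R * ln tR) by rewrite mulrCA ler_wpM2l.
  rewrite -(ler_nat R) !(natrD, natrM) -(natr1 u).
  have -> : s%:R * (6%:R * (3%:R * (u%:R + 1)) + 1) + N%:R * (6%:R * r%:R + 1) =
    18 * (s%:R * u%:R) + 19 * s%:R + 6 * (N%:R * r%:R) + N%:R :> R by ring.
  move: s1 su s_small Nr_le N_le kap_gt k_ge p_big t_big L_big.
  by clear; move: (s%:R * ln _) (s%:R * u%:R) (N%:R * r%:R) => x y z; lra.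
have d_le : d <= (7 / 4) ^+ (l.+1 ^ 2).
  rewrite dL; apply: le_trans (_ : expR ((l.+1 ^ 2)%:R * (81 / 169)) <= _).
    by rewrite ler_expR exponent_le.
  by rewrite expRM_natl lerXn2r ?nnegrE ?expR_ge0 ?expR81_le //; lra.
have t_ge100 : 100 <= tR by move: t_big L_big; clear; lra.
have few : (a * c <= b * (t - 2))%N.
  rewrite -(ler_nat R) !natrM natrB; last by rewrite -(ler_nat R); move: t_ge100; clear; lra.
  by rewrite a_eq; apply: few_bad_real c_le N_le b_gt.
have c_small : c%:R <= N%:R / 50 :> R.
  have d_ge1 : 1 <= d by move: d_L2; have := sqr_ge0 L; clear; lra.
  exact: small_c_real d_ge1 (ler0n _ _) c_le.
exists k, kap, l, N, r, (3 * u.+1)%N, c, b, beta; split=> //.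
  by rewrite -(ltr0n R); move: k_ge p_big t_big L_big; clear; lra.
split=> //.
- rewrite -(ler_nat R) natrD natrM; move: l_le k_ge p_big t_big L_big; clear; lra.
- by rewrite -(ler_nat R) natrM; move: kap_le; have := ler0n R k; clear; lra.
- apply: dominating_rounds; rewrite -(ltr_nat R) natrX natrD.
  apply: lt_le_trans (power_four_large tR_gt0).
  by move: kD D_hi p_small p_big t_big L_big; clear; lra.
- exact: hub_ok.
- by rewrite -(ltr0n R); move: l_gt' L_big; clear; lra.
- by rewrite -(ltr0n R); move: N_gt t_big L_big; clear; lra.
- rewrite -(ler_nat R) natrD !natrM; move: Nl_le k_ge kap_le p_big t_big L_big; clear.
  by move: (N%:R * l%:R) => x; lra.
- exact: part_ok.
- by move=> n n_le; rewrite truncn_ge_nat // mulr_ge0 // ltW.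
- by rewrite -(ltr_nat R) -/tR; move: t_big L_big; clear; lra.
- rewrite -(ler_nat R) !(natrM, natrD) -/tR.
  by move: c_small b_le N_le N_gt t_ge100; clear; lra.
Qed.

(** * The bound on the threshold *)

Lemma avg_deg_arcs (R : realType) (G : sgraph) :
  (0 < #|G|)%N -> #|arcs G|%:R = avg_deg R G * #|G|%:R.
Proof.
by move=> G_gt0; rewrite /avg_deg divfK ?pnatr_eq0 -?lt0n // card_arcs natrM.
Qed.

Lemma avg_deg_le_card (R : realType) (G : sgraph) :
  (0 < #|G|)%N -> avg_deg R G <= #|G|%:R.
Proof.
move=> G_gt0; have G0 : 0 < #|G|%:R :> R by rewrite ltr0n.
rewrite -(ler_pM2r G0) -avg_deg_arcs // -natrM ler_nat -card_prod.
exact: max_card.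
Qed.

Lemma host_parameters_minor (R : realType) (H : sgraph) (S : {set H})
    (k kap l N r r' c b : nat) (beta : R) (G : sgraph) : (0 < k)%N ->
  host_parameters #|S| #|delete_vertices S| #|arcs (delete_vertices S)|
    k kap l N r r' c b beta ->
  (0 < #|G|)%N -> (2 * k)%:R <= avg_deg R G -> minor H G.
Proof.
move=> k_gt0 params G_gt0 dense.
apply: (dense_nbhd k_gt0) (G_gt0) _ => [G' U U_ne sU degU|]; last first.
  by rewrite -(ler_nat R) avg_deg_arcs // natrM ler_wpM2r.
have kap_le : (20 * kap <= k)%N by case: params.
have [U' [U'_ne sU' degU' linkU']] := link_dichotomy k_gt0 kap_le U_ne sU degU.
exact: host_minor params U'_ne sU' degU' linkU'.
Qed.

Theorem theorem1 (R : realType) :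
  exists d0 : R,
    forall s t : nat,
      (3 <= t)%N ->
      s%:R <= 10 ^- 5 * (t%:R / ln t%:R) :> R ->
      forall (H : sgraph) (S : {set H}),
        #|H| = (s + t)%N ->
        #|S| = s ->
        d0 <= avg_deg R (delete_vertices S) ->
        (minor_threshold R H <=
          ((3895 / 1000) * t%:R
            * Num.sqrt (ln (avg_deg R (delete_vertices S))))%:E)%E.
Proof.
have [d0 params] := admissible_parameters R; exists d0 => s t t_ge3 s_le H S cH cS d_ge.
have cV : #|delete_vertices S| = t.
  rewrite card_sig; have := cardsC S; rewrite cH cS => /addnI <-.
  by apply: eq_card => x; rewrite !inE.
have V_gt0 : (0 < #|delete_vertices S|)%N by rewrite cV (leq_trans _ t_ge3).
have d_le := avg_deg_le_card R V_gt0.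
have a_eq := avg_deg_arcs R V_gt0; rewrite cV in d_le a_eq.
have [k [kap [l [N [r [r' [c [b [beta [k_gt0 kD par]]]]]]]]]] := params _ _ _ _ d_ge d_le a_eq s_le.
apply: ereal_inf_lbound; eexists; last by [].
move=> G G_gt0 dense.
rewrite -cS -cV in par; exact: host_parameters_minor k_gt0 par G_gt0 (le_trans kD dense).
Qed.
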